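(* Let $d>1$ be an integer and let $P$ be the $d\times d$ transition probability matrix of an irreducible and aperiodic Markov chain with $d$ states. If $P$ is nonresonant, then $P$ is Benford; that is, for every $(i,j)\in\{1,\ldots,d\}^2$, each of the two real sequences $\bigl((P^n-P^* )^{(i,j)}\bigr)_{n\in\mathbb{N}}$ and $\bigl((P^{n+1}-P^n)^{(i,j)}\bigr)_{n\in\mathbb{N}}$ is either Benford or eventually zero, where $P^*=\lim_{n\to\infty}P^n$.
   Context: Conventions: $\log$ denotes the base-$10$ logarithm, $\log 0:=0$, $\arg 0:=0$, and for $z\in\mathbb{C}\setminus\{0\}$, $\arg z$ is the unique number in $(-\pi,\pi]$ with $z=|z|e^{i\arg z}$. $A^{(i,j)}$ denotes the $(i,j)$ entry of a matrix $A$. Significand: for $x>0$, $S(x)$ is the unique number $s\in[1,10)$ with $x=10^k s$ for some $k\in\mathbb{Z}$; $S(0):=0$. Benford sequence: a sequence $(x_n)$ of real numbers is Benford if $\lim_{n\to\infty}\frac{\#\{j\le n: S(|x_j|)\le t\}}{n}=\log t$ for all $t\in[1,10)$. A sequence is eventually zero if all but finitely many of its terms are $0$. A transition probability matrix is a row-stochastic matrix (nonnegative real entries, each row summing to $1$). For $P$ irreducible and aperiodic, the limit $P^*=\lim_{n\to\infty}P^n$ exists, and $\lambda_1=1$ is the eigenvalue of $P$ of largest modulus. Spectrum: $\sigma(P)\subset\mathbb{C}$ is the set of distinct eigenvalues of $P$, $\lambda_1=1$, and $\sigma(P)^+=\{\lambda\in\sigma(P):\operatorname{Im}\lambda\ge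 0\}$. Rational independence: real numbers $x_1,\ldots,x_k$ are rationally independent if $\sum_{j=1}^k q_jx_j=0$ with $q_1,\ldots,q_k\in\mathbb{Q}$ implies $q_1=\cdots=q_k=0$. Nonresonance: a stochastic matrix $P$ is nonresonant if every nonempty subset $\Lambda_0=\{\lambda_{i_1},\ldots,\lambda_{i_k}\}\subset\sigma(P)^+\setminus\{\lambda_1\}$ with $|\lambda_{i_1}|=\cdots=|\lambda_{i_k}|=L_0$ satisfies $\#(\Lambda_0\cap\mathbb{R})\le 1$, and the numbers $1$, $\log L_0$ and the elements of $\frac{1}{2\pi}\arg\Lambda_0$ are rationally independent, where $\frac{1}{2\pi}\arg\Lambda_0:=\left\{\frac{1}{2\pi}\arg\lambda_{i_1},\ldots,\frac{1}{2\pi}\arg\lambda_{i_k}\right\}\setminus\left\{0,\frac12\right\}$. *)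

(* Defs.v *)
From HB Require Import structures.
From mathcomp Require Import all_boot all_order all_algebra finmap.
From mathcomp Require Import all_classical all_reals all_analysis.
From mathcomp Require Import complex.

Set Implicit Arguments.
Unset Strict Implicit.
Unset Printing Implicit Defensive.

Import Order.TTheory GRing.Theory Num.Theory.
Import numFieldNormedType.Exports.

Local Open Scope classical_set_scope.
Local Open Scope ring_scope.
Local Open Scope complex_scope.

(* [ln 0 = 0] in the library, so this respects the convention [log 0 := 0]. *)
Definition log10 {R : realType} (x : R) : R := ln x / ln 10.

(* Since [carg z] is only constrained through [z = |z| e^(i t)], the value at
   [0] has to be set separately. *)
Definition carg {R : realType} (z : R[i]) : R :=
  if z == 0 then 0
  else xget 0 [set t : R | - pi < t <= pi /\ z = `|z| * (cos t +i* sin t)].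

(* For [x = 0] the set is empty, so that [significand 0 = 0]. *)
Definition significand {R : realType} (x : R) : R :=
  xget 0 [set s : R | 1 <= s < 10 /\ exists k : int, x = 10 ^ k * s].

(* Sequences are indexed from 1: the term [x 0] is not counted. *)
Definition benford {R : realType} (x : nat -> R) : Prop :=
  forall t : R, 1 <= t < 10 ->
    (count (fun j => significand `|x j| <= t) (iota 1 n))%:R / n%:R
      @[n --> \oo] --> log10 t.

Definition eventually_zero {R : realType} (x : nat -> R) : Prop :=
  finite_set [set n | x n != 0].

Definition stochastic {R : realType} {d : nat} (P : 'M[R]_d) : Prop :=
  (forall i j, 0 <= P i j) /\ (forall i, \sum_j P i j = 1).

Definition irreducible {R : realType} {d : nat} (P : 'M[R]_d) : Prop :=
  forall i j, exists n : nat, 0 < (P ^+ n) i j.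

(* [p] is the gcd of the possible return times [n >= 1] to the state [i]. *)
Definition is_period {R : realType} {d : nat} (P : 'M[R]_d) (i : 'I_d)
    (p : nat) : Prop :=
  (forall n : nat, (0 < n)%N -> 0 < (P ^+ n) i i -> (p %| n)%N) /\
  (forall q : nat,
     (forall n : nat, (0 < n)%N -> 0 < (P ^+ n) i i -> (q %| n)%N) ->
     (q %| p)%N).

Definition aperiodic {R : realType} {d : nat} (P : 'M[R]_d) : Prop :=
  forall i, is_period P i 1.

Definition Pstar {R : realType} {d : nat} (P : 'M[R]_d) : 'M[R]_d :=
  lim (P ^+ n @[n --> \oo]).

Definition spectrum {R : realType} {d : nat} (P : 'M[R]_d) : set R[i] :=
  [set z | eigenvalue (map_mx (real_complex R) P) z].

Definition spectrum_plus {R : realType} {d : nat} (P : 'M[R]_d) : set R[i] :=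
  [set z | spectrum P z /\ 0 <= complex.Im z].

(* The numbers are given as a list with multiplicities: a list with a repeated
   entry is not rationally independent. *)
Definition rationally_independent {R : realType} (s : seq R) : Prop :=
  forall q : 'I_(size s) -> rat,
    \sum_(j < size s) ratr (q j) * s`_j = 0 -> forall j, q j = 0.

Definition scaled_args {R : realType} (L : {fset R[i]}) : {fset R} :=
  ([fset carg z / (2 * pi) | z in L] `\` [fset 0; 1 / 2])%fset.

Definition nonresonant {R : realType} {d : nat} (P : 'M[R]_d) : Prop :=
  forall (L : {fset R[i]}) (L0 : R),
    L != fset0 ->
    [set` L] `<=` spectrum_plus P `\ 1 ->
    (forall z, z \in L -> `|z| = L0%:C) ->
    (#|` [fset z in L | complex.Im z == 0%R]%fset | <= 1)%N /\
    rationally_independent [:: 1, log10 L0 & enum_fset (scaled_args L)].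

Definition benford_matrix {R : realType} {d : nat} (P : 'M[R]_d) : Prop :=
  forall i j : 'I_d,
    (benford (fun n => (P ^+ n - Pstar P) i j) \/
     eventually_zero (fun n => (P ^+ n - Pstar P) i j)) /\
    (benford (fun n => (P ^+ n.+1 - P ^+ n) i j) \/
     eventually_zero (fun n => (P ^+ n.+1 - P ^+ n) i j)).

(* Main.v *)
Require Import Defs.
From mathcomp Require Import all_boot all_order all_algebra.
From mathcomp Require Import all_classical all_reals all_analysis.
From mathcomp Require Import finmap complex ring lra zify.

(* With the chain expanded over its spectrum, each of the two sequences is
   x_n = sum_z Re (p_z(n) z^n), z ranging over the eigenvalues other than 1 in
   the closed upper half plane. Nonresonance forces 0 < |z| < 1 there. If L is
   the largest modulus present and D the largest degree of a p_z with |z| = L,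
   then x_n = L^n n^D (f_n + o(1)), where f_n is a real trigonometric polynomial
   in the n theta_z, theta_z = arg z / 2 pi.

   The argument replaces integrals over tori by rotations. A sequence chi with
   |chi| <= 1 and chi_(n+1) - w chi_n -> 0, w <> 1, has mean 0. Hence if
   h b + q is never an integer for h <> 0 and q in V, then multiplying the
   frequency-b component of a polynomial expression in such sequences by a
   unimodular constant does not change its mean. With b = theta_z and
   equidistributed rotations, f_n is small only rarely, since a nonconstant
   r + w u + w' / u is small at two at most of K fixed points u of the unit
   circle. With b = log L, the fraction of n for which log |x_n| mod 1 lies in an
   arc of length tau is at most tau + o(1); applied to an arc and to its
   complement, this gives the Benford law. Polynomials (Bernstein) approximate
   the Lipschitz test functions, so only polynomial expressions are averaged. *)

Set Implicit Arguments.
Unset Strict Implicit.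
Unset Printing Implicit Defensive.

Import Order.TTheory GRing.Theory Num.Theory.
Import numFieldNormedType.Exports.
Import Normc.

Local Open Scope classical_set_scope.
Local Open Scope ring_scope.
Local Open Scope complex_scope.

Section Cis.
Variable R : realType.
Implicit Types (x y : R) (z w : R[i]).

Definition cis x : R[i] := cos (2 * pi * x) +i* sin (2 * pi * x).

Lemma cisD x y : cis (x + y) = cis x * cis y.
Proof.
rewrite /cis mulrDr cosD sinD; simpc.
by rewrite [X in _ +i* X]addrC [cos _ * sin _]mulrC [X in _ +i* (_ + X)]mulrC;
   congr (_ +i* _); ring.
Qed.

Lemma cis0 : cis 0 = 1.
Proof. by rewrite /cis mulr0 cos0 sin0. Qed.

Lemma normc_cis x : normc (cis x) = 1.
Proof. by rewrite /= cos2Dsin2 sqrtr1. Qed.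

Lemma conj_cis x : conjc (cis x) = cis (- x).
Proof. by rewrite /cis mulrN cosN sinN. Qed.

Lemma cisN x : cis (- x) = (cis x)^-1.
Proof.
have h : cis x * cis (- x) = 1 by rewrite -cisD subrr cis0.
have h0 : cis x != 0.
  by apply/eqP => h0; move: h; rewrite h0 mul0r => /esym/eqP; rewrite oner_eq0.
by apply: (mulfI h0); rewrite h mulfV.
Qed.

Lemma cis1 : cis 1 = 1.
Proof. by rewrite /cis mulr1 mulr_natl cos2pi sin2pi. Qed.

Lemma cis_natM (n : nat) x : cis (n%:R * x) = cis x ^+ n.
Proof.
elim: n => [|n IH]; first by rewrite mul0r cis0 expr0.
by rewrite -addn1 natrD mulrDl mul1r cisD IH exprD expr1.
Qed.

Lemma cis_int (m : int) : cis m%:~R = 1.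
Proof.
have hn (n : nat) : cis n%:R = 1 by rewrite -[n%:R]mulr1 cis_natM cis1 expr1n.
case: m => n; first exact: hn.
by rewrite NegzE rmorphN /= cisN hn invr1.
Qed.

Lemma cis_floor x : cis x = cis (x - (Num.floor x)%:~R).
Proof. by rewrite cisD cisN cis_int invr1 mulr1. Qed.

(** Only the fractional part f of x matters. As 1 - cos (2 pi f) is twice the square of sin (pi f),
    which is positive for 0 < f < 1, f must be 0. *)
Lemma cis_eq1 x : cis x = 1 -> exists m : int, x = m%:~R.
Proof.
rewrite cis_floor; set f := x - _ => -[hc hs].
exists (Num.floor x); apply/eqP; rewrite -subr_eq0 -/f; apply/eqP.
have f0 : 0 <= f by rewrite subr_ge0 ge_floor.
have f1 : f < 1 by rewrite ltrBlDr addrC; have := floorD1_gt x; rewrite intrD addrC.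
have [//|fn0] := eqVneq f 0.
have pf0 : 0 < pi * f by rewrite mulr_gt0 ?pi_gt0 // lt_def fn0.
have : 0 < sin (pi * f).
  by apply: sin_gt0_pi; rewrite pf0 /= -[ltRHS]mulr1 ltr_pM2l ?pi_gt0.
have hs0 : sin (pi * f) ^+ 2 = 0.
  have e : 2 * pi * f = (pi * f) *+ 2 by rewrite mulr2n; ring.
  by move: hc; rewrite e cos_mulr2n cos2sin2; set s := sin _ ^+ 2; lra.
by move/eqP: hs0; rewrite expf_eq0 /= => /eqP ->; rewrite ltxx.
Qed.

Lemma normcB z w : normc (z - w) = normc (w - z).
Proof. by rewrite -opprB normcN. Qed.

Lemma normc_ge0 z : 0 <= normc z.
Proof. by case: z => a b; rewrite sqrtr_ge0. Qed.

Lemma normcR x : normc (x%:C) = `|x|.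
Proof. by rewrite /= expr0n /= addr0 sqrtr_sqr. Qed.

Lemma normcX z n : normc (z ^+ n) = normc z ^+ n.
Proof.
by elim: n => [|n IH]; rewrite ?expr0 ?normc1 // !exprS normcM IH.
Qed.

Lemma normc_sum (I : Type) (s : seq I) (F : I -> R[i]) :
  normc (\sum_(i <- s) F i) <= \sum_(i <- s) normc (F i).
Proof.
elim: s => [|i s IH]; first by rewrite !big_nil normc0.
by rewrite !big_cons (le_trans (le_normcD _ _)) // lerD2l.
Qed.

Lemma normc_Re z : `|complex.Re z| <= normc z.
Proof. by have := normc_ge_Re z; rewrite lecR. Qed.

Lemma normcE z : `|z| = (normc z)%:C. Proof. by case: z. Qed.

Lemma normc_eq0 z : (normc z == 0) = (z == 0).
Proof. by apply/eqP/eqP => [/eq0_normc//|->]; rewrite normc0. Qed.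

Lemma cis_neq0 x : cis x != 0.
Proof. by rewrite -normc_eq0 normc_cis oner_eq0. Qed.

Lemma conjcM z w : conjc (z * w) = conjc z * conjc w.
Proof. exact: rmorphM. Qed.

Lemma normc_conj z : normc (conjc z) = normc z.
Proof. by case: z => a b /=; rewrite sqrrN. Qed.

Lemma ReD z w : complex.Re (z + w) = complex.Re z + complex.Re w.
Proof. by case: z; case: w. Qed.

Lemma ReB z w : complex.Re (z - w) = complex.Re z - complex.Re w.
Proof. by case: z; case: w. Qed.

Lemma Re_realM x z : complex.Re (x%:C * z) = x * complex.Re z.
Proof. by case: z => a b /=; rewrite mul0r subr0. Qed.

Lemma Re_sum (I : Type) (s : seq I) (P : pred I) (F : I -> R[i]) :
  complex.Re (\sum_(i <- s | P i) F i) = \sum_(i <- s | P i) complex.Re (F i).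
Proof. by apply: (big_morph _ ReD). Qed.

Lemma normc_IR z : normc z <= `|complex.Re z| + `|complex.Im z|.
Proof.
case: z => a b /=; rewrite -[leRHS]ger0_norm ?addr_ge0 // -sqrtr_sqr ler_wsqrtr //.
rewrite sqrrD !real_normK ?num_real // lerD2r lerDl.
by rewrite mulrn_wge0 // mulr_ge0.
Qed.

Lemma sin_le_norm x : `|sin x| <= `|x|.
Proof.
have H y : 0 < y -> `|sin y| <= y.
  move=> y0; have [c cin ->] : exists2 c, c \in `]0, y[%R & sin y = cos c * y.
    have [c cin h] := @MVT R sin cos 0 y y0
      (fun c _ => @is_derive_sin R c) (continuous_subspaceT (@continuous_sin R)).
    by exists c => //; move: h; rewrite sin0 !subr0.
  by rewrite normrM (gtr0_norm y0) ler_piMl ?(ltW y0) // cos_max.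
have [x0|x0|->] := ltgtP x 0.
- have x0' : 0 < - x by rewrite oppr_gt0.
  by rewrite -[x in sin x]opprK sinN normrN -[leRHS]normrN (gtr0_norm x0') H.
- by rewrite (gtr0_norm x0) H.
- by rewrite sin0.
Qed.

(** Factoring out the midpoint character leaves 2i sin (pi (x - y)), whose modulus is bounded by
    [sin_le_norm]. *)
Lemma cis_lipschitz x y : normc (cis x - cis y) <= 2 * pi * `|x - y|.
Proof.
have -> : cis x - cis y = cis ((x + y) / 2) * (0 +i* (2 * sin (pi * (x - y)))).
  have -> : cis x - cis y = cis ((x + y) / 2) * (cis ((x - y) / 2) - cis (- ((x - y) / 2))).
    by rewrite mulrBr -!cisD; congr (cis _ - cis _); field.
  congr (_ * _); rewrite -conj_cis /cis; simpc; congr (_ +i* _).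
  by rewrite (_ : pi * (x - y) = 2 * pi * ((x - y) / 2)); [ring | field].
rewrite normcM normc_cis mul1r /= expr0n /= add0r sqrtr_sqr normrM.
rewrite ger0_norm // -mulrA ler_pM2l // (le_trans (sin_le_norm _)) //.
by rewrite normrM ger0_norm // pi_ge0.
Qed.

Lemma pi_neq0 : (pi : R) != 0.
Proof. by rewrite gt_eqF // pi_gt0. Qed.

Lemma twopiK x : 2 * pi * (x / (2 * pi)) = x.
Proof. by rewrite mulrC divfK // mulf_neq0 ?pi_neq0 ?pnatr_eq0. Qed.

Lemma cos_lipschitz x y : `|cos x - cos y| <= `|x - y|.
Proof.
have := cis_lipschitz (x / (2 * pi)) (y / (2 * pi)).
have -> : 2 * pi * `|x / (2 * pi) - y / (2 * pi)| = `|x - y|.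
  have {1}-> : 2 * pi = `|2 * pi : R| by rewrite ger0_norm // mulr_ge0 ?pi_ge0.
  by rewrite -normrM mulrBr !twopiK.
move=> h; apply: le_trans h; apply: le_trans (normc_Re _).
by rewrite ReB /= !twopiK.
Qed.

Lemma sin_lipschitz x y : `|sin x - sin y| <= `|x - y|.
Proof.
have := cos_lipschitz (x - pi / 2) (y - pi / 2); rewrite !cosBpihalf.
by have -> : x - pi / 2 - (y - pi / 2) = x - y by ring.
Qed.

End Cis.

(** * Cesaro averages and sequences tending to 0 *)

Section Averages.
Variable R : realType.
Implicit Types (a b : nat -> R[i]) (e : R).

Definition vanish a := forall e, 0 < e -> \forall n \near \oo, normc (a n) <= e.

Lemma vanish_le a (u : nat -> R) :
  (\forall n \near \oo, normc (a n) <= u n) -> u @ \oo --> 0 -> vanish a.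
Proof.
move=> hau hu e e0.
have : \forall n \near \oo, `|u n| <= e by apply: (cvgr0_norm_le u).
move: hau; apply: filterS2 => n h1 h2.
by rewrite (le_trans h1) // (le_trans (ler_norm _)).
Qed.

Lemma vanish_cvg a : vanish a -> normc (a n) @[n --> \oo] --> (0:R).
Proof.
move=> ha; apply/cvgr0Pnorm_le => e e0; apply: filterS (ha e e0) => n /=.
by rewrite ger0_norm // normc_ge0.
Qed.

Lemma vanishD a b : vanish a -> vanish b -> vanish (fun n => a n + b n).
Proof.
move=> ha hb e e0; have e2 : 0 < e / 2 by rewrite divr_gt0.
move: (ha _ e2) (hb _ e2); apply: filterS2 => n h1 h2.
by rewrite (le_trans (le_normcD _ _)) // [leRHS]splitr lerD.
Qed.

Lemma vanish_boundedM a b (B : R) : (forall n, normc (b n) <= B) ->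
  vanish a -> vanish (fun n => b n * a n).
Proof.
move=> hb ha e e0; have B1 : 0 < `|B| + 1 by rewrite ltr_wpDl.
apply: filterS (ha _ (divr_gt0 e0 B1)) => n h.
rewrite normcM mulrC; apply: le_trans (_ : e / (`|B| + 1) * (`|B| + 1) <= _).
  apply: ler_pM; rewrite ?normc_ge0 //.
  by rewrite (le_trans (hb n)) // (le_trans (ler_norm _)) // lerDl.
by rewrite divfK // gt_eqF.
Qed.

Lemma vanish_ext a b : a =1 b -> vanish a -> vanish b.
Proof. by move=> h; rewrite (funext h). Qed.

Definition avg (K : fieldType) (u : nat -> K) (n : nat) : K :=
  (\sum_(i < n) u i) / n%:R.

Lemma avgD (K : fieldType) (u v : nat -> K) n :
  avg (fun i => u i + v i) n = avg u n + avg v n.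
Proof. by rewrite /avg big_split mulrDl. Qed.

Lemma avgZ (K : fieldType) (c : K) (u : nat -> K) n :
  avg (fun i => c * u i) n = c * avg u n.
Proof. by rewrite /avg -mulr_sumr mulrA. Qed.

Lemma avg_sum (K : fieldType) (m : nat) (u : 'I_m -> nat -> K) n :
  avg (fun i => \sum_(j < m) u j i) n = \sum_(j < m) avg (u j) n.
Proof. by rewrite /avg exchange_big mulr_suml. Qed.

Lemma le_avg (u v : nat -> R) n : (forall i, u i <= v i) -> avg u n <= avg v n.
Proof. by move=> h; rewrite ler_wpM2r ?invr_ge0 ?ler0n // ler_sum. Qed.

(** For n = 0 the average is 0 / 0 = 0, whence an inequality and the sign condition on c. *)
Lemma le_avg_const (c : R) n : 0 <= c -> avg (fun=> c) n <= c.
Proof.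
move=> c0; rewrite /avg sumr_const card_ord -[c *+ _]mulr_natr.
case: n => [|n]; first by rewrite mulr0 mul0r.
by rewrite mulfK // pnatr_eq0.
Qed.

Lemma normc_avg a n : normc (avg a n) <= avg (fun i => normc (a i)) n.
Proof.
rewrite /avg normcM normcV (_ : normc n%:R = n%:R); last first.
  by rewrite -(rmorph_nat (real_complex R)) normcR ger0_norm.
by rewrite ler_wpM2r ?invr_ge0 ?ler0n // normc_sum.
Qed.

Lemma cvg_avg (u : nat -> R) (l : R) : u @ \oo --> l -> avg u @ \oo --> l.
Proof.
move=> /cesaro h; rewrite -cvg_shiftS.
apply: cvg_trans h; apply: near_eq_cvg; near=> n.
by rewrite /arithmetic_mean /avg /= mulrC seriesEord.
Unshelve. all: by end_near. Qed.

Lemma vanish_avg a : vanish a -> vanish (avg a).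
Proof.
move=> /vanish_cvg/cvg_avg; apply: vanish_le.
by apply: nearW => n; exact: normc_avg.
Qed.

Lemma avgS_sub (K : fieldType) (u : nat -> K) n :
  avg (fun i => u i.+1) n - avg u n = (u n - u 0%N) / n%:R.
Proof.
rewrite /avg -mulrBl -sumrB.
by rewrite -(big_mkord xpredT (fun i => u i.+1 - u i)) telescope_sumr.
Qed.

(* Averaging is shift invariant up to O(1/n), so the average nearly satisfies
   [A = w * A]. *)
Lemma avg_quasi_char a (w : R[i]) : w != 1 -> (forall n, normc (a n) <= 1) ->
  vanish (fun n => a n.+1 - w * a n) -> vanish (avg a).
Proof.
move=> w1 ha hv.
have d0 : 1 - w != 0 by rewrite subr_eq0 eq_sym.
have -> : avg a = (fun n => (1 - w)^-1 *
    (avg (fun i => a i.+1 - w * a i) n + (- 1) * ((a n - a 0%N) / n%:R))).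
  apply: funext => n; rewrite -avgS_sub.
  have -> : avg (fun i => a i.+1 - w * a i) n =
      avg (fun i => a i.+1) n - w * avg a n.
    by rewrite (avgD (fun i => a i.+1) (fun i => - (w * a i))) -mulNr -avgZ;
       congr (_ + avg _ _); apply: funext => i; rewrite mulNr.
  by apply: (mulfI d0); rewrite mulVKf //; ring.
apply: (@vanish_boundedM _ (fun=> (1 - w)^-1) (normc (1 - w)^-1)) => //.
apply: vanishD; first exact: vanish_avg.
apply: (@vanish_boundedM _ (fun=> -1) 1) => [n|]; first by rewrite normcN normc1.
apply: (@vanish_le _ (fun n => 2 * n%:R^-1)); last first.
  rewrite -(mulr0 (2:R)); apply: cvgM; first exact: cvg_cst.
  by rewrite -cvg_shiftS; exact: cvg_harmonic.
apply: nearW => n; rewrite normcM normcV (_ : normc n%:R = n%:R); last first.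
  by rewrite -(rmorph_nat (real_complex R)) normcR ger0_norm.
rewrite ler_wpM2r ?invr_ge0 ?ler0n // (le_trans (le_normcD _ _)) // normcN.
by rewrite (_ : 2 = 1 + 1) // lerD.
Qed.

End Averages.

(** * Rotating one frequency without changing means *)

Section Rotation.
Variables (R : realType) (V : set R) (b0 rho : R).

(** Here [b0] is the frequency to be rotated and [V] holds the frequencies left alone. In
    [twin a a'], [a] is a linear combination of approximate characters chi of frequencies h b0 + q,
    and [a'] arises by advancing the phase of [b0] by [rho]. This is a relation between sequences
    because the decomposition of [a] need not be unique. *)
Inductive twin : (nat -> R[i]) -> (nat -> R[i]) -> Prop :=
| twin_char (h : int) (q : R) (chi : nat -> R[i]) :
    V q -> (forall n, normc (chi n) <= 1) ->
    vanish (fun n => chi n.+1 - cis (h%:~R * b0 + q) * chi n) ->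
    twin chi (fun n => cis (h%:~R * rho) * chi n)
| twinD a a' b b' : twin a a' -> twin b b' ->
    twin (fun n => a n + b n) (fun n => a' n + b' n)
| twinZ c a a' : twin a a' -> twin (fun n => c * a n) (fun n => c * a' n).

Lemma twin_ext a a' b b' : a =1 b -> a' =1 b' -> twin a a' -> twin b b'.
Proof. by move=> h h'; rewrite (funext h) (funext h'). Qed.

(** For h = 0 the rotation does nothing. For h <> 0 the frequency h b0 + q is not an integer, so
    [avg_quasi_char] gives mean 0 to chi and to its rotated copy alike. *)
Lemma twin_avg a b :
  (forall (h : int) (q : R) (m : int),
     V q -> h%:~R * b0 + q = m%:~R -> h = 0) ->
  twin a b -> vanish (fun n => avg a n - avg b n).
Proof.
move=> hV; elim=> {a b} [h q chi Vq b1 hv|a a' b b' _ IH1 _ IH2|c a a' _ IH].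
- have [->|h0] := eqVneq h 0.
    move=> e e0; apply: nearW => n.
    by rewrite avgZ mul0r cis0 mul1r subrr normc0 ltW.
  have hc : cis (h%:~R * b0 + q) != 1.
    by apply/eqP => /cis_eq1 [m /(hV _ _ _ Vq)/eqP]; rewrite (negPf h0).
  have := avg_quasi_char hc b1 hv.
  move=> /(vanish_boundedM (b := fun=> 1 - cis (h%:~R * rho))
            (fun=> lexx _)); apply: vanish_ext => n.
  by rewrite avgZ mulrBl mul1r.
- apply: vanish_ext (vanishD IH1 IH2) => n; rewrite !avgD; ring.
- have := vanish_boundedM (b := fun=> c) (fun=> lexx (normc c)) IH.
  by apply: vanish_ext => n; rewrite !avgZ mulrBr.
Qed.

Hypothesis V0 : V 0.
Hypothesis VD : forall x y, V x -> V y -> V (x + y).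

Lemma twin_const c : twin (fun=> c) (fun=> c).
Proof.
have h : twin (fun=> 1) (fun=> cis ((0 : int)%:~R * rho) * 1).
  apply: (@twin_char 0 0) => // [n|]; first by rewrite normc1.
  move=> e e0; apply: nearW => n.
  by rewrite mul0r add0r cis0 mulr1 subrr normc0 ltW.
apply: twin_ext (twinZ c h) => n; first by rewrite mulr1.
by rewrite mul0r cis0 !mulr1.
Qed.

(** A product of approximate characters is one for the sum of the frequencies, by the splitting chi'
    (n+1) (chi (n+1) - w chi n) + w chi n (chi' (n+1) - w' chi' n). Bilinearity and a double
    induction do the rest. *)
Lemma twinM a a' b b' : twin a a' -> twin b b' ->
  twin (fun n => a n * b n) (fun n => a' n * b' n).
Proof.
move=> hab; elim: hab b b' => {a a'}
  [h q chi Vq c1 hv|a a' b b' _ IH1 _ IH2|c a a' _ IH] d d'.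
- elim=> {d d'} [h' q' chi' Vq' c1' hv'|a a' b b' _ IH1 _ IH2|c a a' _ IH].
  + apply: (@twin_ext (fun n => chi n * chi' n)
       (fun n => cis ((h + h')%:~R * rho) * (chi n * chi' n))) => // [n|].
      by rewrite rmorphD mulrDl cisD; ring.
    apply: (@twin_char (h + h') (q + q')); first exact: VD.
      by move=> n; rewrite normcM mulr_ile1 // normc_ge0.
    set w := cis (h%:~R * b0 + q) in hv.
    set w' := cis (h'%:~R * b0 + q') in hv'.
    have hw' : forall n, normc (w * chi n) <= 1.
      by move=> n; rewrite normcM normc_cis mul1r.
    have c1'S : forall n, normc (chi' n.+1) <= 1 by [].
    have := vanishD (vanish_boundedM c1'S hv) (vanish_boundedM hw' hv').
    apply: vanish_ext => n.
    have -> : cis ((h + h')%:~R * b0 + (q + q')) = w * w'.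
      by rewrite /w /w' -cisD rmorphD mulrDl; congr cis; ring.
    by ring.
  + by apply: twin_ext (twinD IH1 IH2) => n; ring.
  + by apply: twin_ext (twinZ c IH) => n; ring.
- by move=> hd; apply: twin_ext (twinD (IH1 _ _ hd) (IH2 _ _ hd)) => n; ring.
- by move=> hd; apply: twin_ext (twinZ c (IH _ _ hd)) => n; ring.
Qed.

Lemma twin_horner (p : {poly R[i]}) a b : twin a b ->
  twin (fun n => p.[a n]) (fun n => p.[b n]).
Proof.
move=> hab; elim/poly_ind: p => [|p c IH].
  by apply: twin_ext (twin_const 0) => n; rewrite horner0.
apply: twin_ext (twinD (twinM IH hab) (twin_const c)) => n;
  by rewrite hornerMXaddC.
Qed.

Lemma twin_cis (h : int) (q : R) : V q ->
  twin (fun n => cis (n%:R * (h%:~R * b0 + q)))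
       (fun n => cis (h%:~R * rho) * cis (n%:R * (h%:~R * b0 + q))).
Proof.
move=> Vq; apply: (@twin_char h q) => // [n|e e0]; first by rewrite normc_cis.
apply: nearW => n.
set t := _ + q; rewrite (_ : n.+1%:R * t = t + n%:R * t).
  by rewrite cisD subrr normc0 ltW.
by rewrite -addn1 natrD; ring.
Qed.

End Rotation.

(** * Polynomial approximation of Lipschitz functions *)

Section Bernstein.
Variable R : realType.
Implicit Types (g h : nat -> R) (x : R).

(* [(bern n g).[x]] is the expectation of [g] at a binomial variable with
   parameters [n] and [x]; the recursion conditions on the first trial. *)
Fixpoint bern (n : nat) g : {poly R} :=
  if n is m.+1 then 'X * bern m (g \o S) + (1 - 'X) * bern m g else (g 0%N)%:P.

Lemma bern_le n g h x : 0 <= x <= 1 -> (forall k, g k <= h k) ->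
  (bern n g).[x] <= (bern n h).[x].
Proof.
move=> /andP[x0 x1]; elim: n g h => [|n IH] g h gh /=; first by rewrite !hornerC.
by rewrite !hornerE; apply: lerD; apply: ler_wpM2l; rewrite ?subr_ge0 //; apply: IH => k; exact: gh.
Qed.

Lemma bern_affine n g (a b : R) x :
  (bern n (fun k => a + b * g k)).[x] = a + b * (bern n g).[x].
Proof.
elim: n g => [|n IH] g /=; first by rewrite !hornerC.
by rewrite !hornerE (IH (g \o S)) IH; ring.
Qed.

(** Binomial variance plus squared bias. The centre a is kept general because conditioning on a
    first success replaces it by a - 1. *)
Lemma bern_variance n x (a : R) :
  (bern n (fun k => (k%:R - a) ^+ 2)).[x] =
  n%:R * x * (1 - x) + (n%:R * x - a) ^+ 2.
Proof.
elim: n a => [|n IH] a /=; first by rewrite hornerC; ring.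
have e : (fun k : nat => (k%:R - a) ^+ 2) \o S =
    (fun k => (k%:R - (a - 1)) ^+ 2) :> (nat -> R).
  by apply: funext => k /=; rewrite -[k.+1]addn1 natrD; ring.
by rewrite !hornerE e !IH -[n.+1]addn1 natrD; ring.
Qed.

(** Bernstein's argument: phi (k / n) - phi x is bounded by a constant plus a multiple of (k - n
    x)^2, and the binomial expectation of that square is n x (1 - x). *)
Lemma lipschitz_unit_approx (phi : R -> R) (L e : R) : 0 < e ->
  (forall s t, `|phi s - phi t| <= L * `|s - t|) ->
  exists p : {poly R}, forall x, 0 <= x <= 1 -> `|p.[x] - phi x| <= e.
Proof.
move=> e0 hL.
have L0 : 0 <= L.
  by have := hL 1 0; rewrite subr0 normr1 mulr1; exact: le_trans.
have [m [m0 hm]] : exists m : nat, 0 < m%:R :> R /\ L / m%:R <= e.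
  have [k hk] : exists k : nat, L / e < k%:R.
    by exists (Num.bound (L / e)); rewrite archi_boundP // divr_ge0 // ltW.
  have k0 : 0 < k%:R :> R by rewrite (le_lt_trans _ hk) // divr_ge0 // ltW.
  by exists k; split=> //; rewrite ler_pdivrMr // mulrC -ler_pdivrMr // ltW.
(* With n = m^2 the deviation of k / n from x is of order 1 / m, so that the total error is at most
   L / m. *)
pose n := (m ^ 2)%N.
have nE : n%:R = m%:R ^+ 2 :> R by rewrite natrX.
exists (bern n (fun k => phi (k%:R / n%:R))) => x /andP[x0 x1].
have mn0 : m%:R != 0 :> R by rewrite gt_eqF.
pose A : R := L / m%:R / 2.
pose B : R := L / (2 * m%:R ^+ 3).
have B0 : 0 <= B by rewrite divr_ge0 // mulr_ge0 // exprn_ge0 // ltW.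
(* AM-GM: [2 |s| <= 1 / m + m s^2] with [s = k / n - x] *)
have key k : `|phi (k%:R / n%:R) - phi x| <= A + B * (k%:R - n%:R * x) ^+ 2.
  apply: le_trans (hL _ _) _.
  set s := _ - x.
  have -> : A + B * (k%:R - n%:R * x) ^+ 2 = L * ((m%:R^-1 + m%:R * `|s| ^+ 2) / 2).
    rewrite real_normK ?num_real // /A /B /s nE; field; exact: mn0.
  rewrite ler_wpM2l // ler_pdivlMr // -subr_ge0.
  have -> : m%:R^-1 + m%:R * `|s| ^+ 2 - `|s| * 2 = m%:R^-1 * (1 - m%:R * `|s|) ^+ 2.
    by field.
  by rewrite mulr_ge0 ?sqr_ge0 // invr_ge0 ltW.
have tot : A + B * (n%:R * x * (1 - x)) <= e.
  apply: le_trans hm.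
  have -> : B * (n%:R * x * (1 - x)) = A * (x * (1 - x)).
    by rewrite /A /B nE; field.
  have A0 : 0 <= A by rewrite !divr_ge0 // ltW.
  have : A * (x * (1 - x)) <= A * 1.
    by rewrite ler_wpM2l // mulr_ile1 // ?subr_ge0 // lerBlDr lerDl.
  have -> : L / m%:R = A + A by rewrite /A; field.
  by rewrite mulr1 lerD2l.
clearbody A B.
have x01 : 0 <= x <= 1 by rewrite x0.
have V : (bern n (fun k => (k%:R - n%:R * x) ^+ 2)).[x] = n%:R * x * (1 - x).
  by rewrite bern_variance subrr expr0n addr0.
rewrite ler_norml; apply/andP; split.
  rewrite lerBrDr -[leRHS]addr0 -lerBlDr.
  have := @bern_le n (fun k => (phi x - A) + (- B) * (k%:R - n%:R * x) ^+ 2)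
    (fun k => phi (k%:R / n%:R)) x x01.
  rewrite bern_affine V; set T := _.[x] => h.
  have : phi x - A + - B * (n%:R * x * (1 - x)) <= T.
    apply: h => k; have := key k; rewrite ler_norml => /andP[+ _]; lra.
  by lra.
have := @bern_le n (fun k => phi (k%:R / n%:R))
  (fun k => (phi x + A) + B * (k%:R - n%:R * x) ^+ 2) x x01.
rewrite bern_affine V; set T := _.[x] => h.
have : T <= phi x + A + B * (n%:R * x * (1 - x)).
  apply: h => k; have := key k; rewrite ler_norml => /andP[_ +]; lra.
by lra.
Qed.

(** The affine map between [0, 1] and [-M, M] multiplies the Lipschitz constant by 2 M. *)
Lemma lipschitz_approx (phi : R -> R) (L M e : R) : 0 < M -> 0 < e ->
  (forall s t, `|phi s - phi t| <= L * `|s - t|) ->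
  exists p : {poly R}, forall s, `|s| <= M -> `|p.[s] - phi s| <= e.
Proof.
move=> M0 e0 hL.
have M20 : 0 < 2 * M by rewrite mulr_gt0.
have [|p hp] := @lipschitz_unit_approx (fun t => phi (2 * M * t - M)) (L * (2 * M)) e e0.
  move=> s t; apply: le_trans (hL _ _) _.
  have -> : 2 * M * s - M - (2 * M * t - M) = 2 * M * (s - t) by ring.
  by rewrite normrM (gtr0_norm M20) !mulrA.
exists (p \Po ((2 * M)^-1 *: 'X + (2^-1)%:P)) => s; rewrite ler_norml => /andP[h1 h2].
rewrite horner_comp !hornerE.
have Mn0 : M != 0 by rewrite gt_eqF.
set t := (2 * M)^-1 * s + 2^-1.
have -> : phi s = phi (2 * M * t - M) by congr phi; rewrite /t; field.

apply: hp; rewrite /t.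
have -> : (2 * M)^-1 * s + 2^-1 = (s + M) / (2 * M) by field.
by rewrite divr_ge0 ?ler_pdivrMr //=; lra.
Qed.

End Bernstein.

(** * Averaging over finitely many rotations *)

Section RotationAverage.
Variables (R : realType) (V : set R) (b0 : R).
Hypothesis V0 : V 0.
Hypothesis VD : forall x y, V x -> V y -> V (x + y).
Hypothesis V_free : forall (h : int) (q : R) (m : int),
  V q -> h%:~R * b0 + q = m%:~R -> h = 0.

Lemma twin_avg_real rho (u v : nat -> R) (p : {poly R}) e : 0 < e ->
  twin V b0 rho (fun n => (u n)%:C) (fun n => (v n)%:C) ->
  \forall n \near \oo, avg (fun i => p.[u i]) n <= avg (fun i => p.[v i]) n + e.
Proof.
move=> e0 /(twin_horner V0 VD (map_poly (real_complex R) p)).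
move=> /(twin_avg V_free)/(_ e e0); apply: filterS => n h.
have avgC (w : nat -> R) : avg (fun i => (map_poly (real_complex R) p).[(w i)%:C]) n
    = (avg (fun i => p.[w i]) n)%:C.
  rewrite /avg rmorphM fmorphV rmorph_nat rmorph_sum; congr (_ / _).
  by apply: eq_bigr => i _; rewrite horner_map.
rewrite !avgC -rmorphB normcR in h.
by rewrite -lerBlDl (le_trans (ler_norm _)).
Qed.

(** The time average of p (u) is, up to e, at most that of the mean over the K rotated copies. This
    finite mean takes the place of an integral over the circle. *)
Lemma rotation_avg (K : nat) (u : nat -> R) (v : 'I_K -> nat -> R)
    (p : {poly R}) e : (0 < K)%N -> 0 < e ->
  (forall j : 'I_K, twin V b0 (j%:R / K%:R) (fun n => (u n)%:C) (fun n => (v j n)%:C)) ->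
  \forall n \near \oo,
    avg (fun i => p.[u i]) n <= avg (fun i => K%:R^-1 * \sum_j p.[v j i]) n + e.
Proof.
move=> K0 e0 huv.
have : \forall n \near \oo, forall j : 'I_K,
    avg (fun i => p.[u i]) n <= avg (fun i => p.[v j i]) n + e.
  by apply: filter_forall => j; exact: twin_avg_real (huv j).
apply: filterS => n h; rewrite avgZ (avg_sum (fun j i => p.[v j i])).
have K0' : 0 < K%:R :> R by rewrite ltr0n.
rewrite -lerBlDr ler_pdivlMl // -[leLHS]/(_ * _) mulr_natl.
rewrite -[K in leLHS]card_ord -sumr_const ler_sum // => j _.
by rewrite lerBlDr.
Qed.

End RotationAverage.

(** * Few small values of r + w u + w' / u on the unit circle *)

Section ThreePoints.
Variable R : realType.

(** The constant [kappa] depends on the points alone, so that the bound is uniform in r, w and w',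
    which will vary with the time n. *)
Lemma three_points (K : nat) (om : 'I_K -> R[i]) : injective om ->
  (forall j, normc (om j) = 1) ->
  exists2 kappa : R, 0 < kappa & forall r w w' : R[i], w != 0 ->
    (#|[pred j : 'I_K | (normc (r + w * om j + w' * (om j)^-1) <= kappa * normc w)%R]| <= 2)%N.
Proof.
move=> inj_om om1.
have [delta d0 hd] : exists2 delta : R, 0 < delta &
    forall i j, i != j -> delta <= normc (om i - om j).
  exists (\big[Num.min/1]_(ij : 'I_K * 'I_K | ij.1 != ij.2) normc (om ij.1 - om ij.2)).
    apply: lt_bigmin => // -[i j] /= ij.
    by rewrite lt_def normc_ge0 andbT normc_eq0 subr_eq0 (inj_eq inj_om).
  by move=> i j ij; apply: (bigmin_le_cond _ (j := (i, j))).
(* With delta the least distance between the points, each of the three terms of the divided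
   difference is at most |w| / 6. Their sum w would have modulus at most |w| / 2. *)
exists (delta ^+ 2 / 6); first by rewrite divr_gt0 // exprn_gt0.
move=> r w w' w0; rewrite leqNgt; apply/negP => /card_gt2P.
move=> [i [j [k [[]]]]]; rewrite !inE => hi hj hk [ij jk ki].
set kw := _ * normc w in hi hj hk.
have om_neq0 l : om l != 0 by rewrite -normc_eq0 om1 oner_eq0.
pose val l := r + w * om l + w' * (om l)^-1.
have sub_neq0 l m : l != m -> om l - om m != 0.
  by move=> lm; rewrite subr_eq0 (inj_eq inj_om).
have ji := ij; rewrite eq_sym in ji; have kj := jk; rewrite eq_sym in kj.
have ik := ki; rewrite eq_sym in ik.
(* [om l * val l] is a quadratic polynomial in [om l] with leading coefficient
   [w]: its second divided difference is [w] *)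
have wE : w = om i * val i / ((om i - om j) * (om i - om k)) +
              om j * val j / ((om j - om i) * (om j - om k)) +
              om k * val k / ((om k - om i) * (om k - om j)).
  by rewrite /val; field; rewrite !om_neq0 !sub_neq0.
have term l m n : l != m -> l != n -> normc (val l) <= kw ->
    normc (om l * val l / ((om l - om m) * (om l - om n))) <= normc w / 6.
  move=> lm ln hl; rewrite !normcM om1 mul1r normcV normcM.
  have -> : normc w / 6 = kw / delta ^+ 2.
    by rewrite /kw; field; rewrite gt_eqF.
  rewrite ler_pM ?normc_ge0 ?invr_ge0 ?mulr_ge0 ?normc_ge0 //.
  rewrite lef_pV2 ?posrE ?exprn_gt0 ?mulr_gt0 ?(lt_le_trans d0) ?hd //.
  by rewrite expr2 ler_pM ?hd // ltW.
have w_gt0 : 0 < normc w by rewrite lt_def normc_ge0 andbT normc_eq0.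
have := le_trans (le_normcD _ _) (lerD (le_trans (le_normcD _ _)
   (lerD (term i j k ij ik hi) (term j i k ji jk hj))) (term k i j ki kj hk)).
by rewrite -wE; lra.
Qed.

End ThreePoints.

(** * A trigonometric polynomial with a free frequency is rarely small *)

Section SmallValues.
Variables (R : realType) (V : set R) (th : R).
Hypothesis V0 : V 0.
Hypothesis VD : forall x y, V x -> V y -> V (x + y).
Hypothesis V_free : forall (h : int) (q : R) (m : int),
  V q -> h%:~R * th + q = m%:~R -> h = 0.

Lemma root_of_unity_inj (K : nat) : (0 < K)%N ->
  injective (fun j : 'I_K => cis (j%:R / K%:R : R)).
Proof.
move=> K0 i j hij; have Kn0 : K%:R != 0 :> R by rewrite pnatr_eq0 -lt0n.
have : cis ((i%:R - j%:R) / K%:R : R) = 1.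
  rewrite mulrBl cisD hij -cisD subrr cis0 //.
move=> /cis_eq1 [m /(congr1 (fun x => x * K%:R))]; rewrite divfK // => hm.
have {}hm : (i : nat)%:Z - (j : nat)%:Z = m * K%:Z.
  by apply/eqP; rewrite -(eqr_int R) rmorphB rmorphM /= hm.
have := ltn_ord i; have := ltn_ord j => hj hi.
apply/val_inj => /=; case: (ltrgtP m 0) => m0; last by lia.
  by have : m * K%:Z <= - K%:Z; nia.
by have : m * K%:Z >= K%:Z; nia.
Qed.

(** A trapezoid: 1 for |s| <= e, 0 for |s| >= 2 e, linear in between. *)
Definition bump (e s : R) : R := Num.max 0 (Num.min 1 (2 - `|s| / e)).

Lemma maxmin_lipschitz (a b : R) :
  `|Num.max 0 (Num.min 1 a) - Num.max 0 (Num.min 1 b)| <= `|a - b|.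
Proof.
have h1 := ler_norm (a - b); have h2 := ler_norm (b - a); rewrite distrC in h2.
by rewrite ler_norml /Num.max /Num.min; case: (ltP 1 a) => ?; case: (ltP 1 b) => ?;
  repeat case: ltP => ?; lra.
Qed.

Lemma bump_lipschitz e : 0 < e ->
  forall s t, `|bump e s - bump e t| <= e^-1 * `|s - t|.
Proof.
move=> e0 s t; apply: le_trans (maxmin_lipschitz _ _) _.
have -> : 2 - `|s| / e - (2 - `|t| / e) = e^-1 * (`|t| - `|s|) by ring.
rewrite normrM ger0_norm ?invr_ge0 ?(ltW e0) // ler_pM2l ?invr_gt0 // [leRHS]distrC.
exact: ler_dist_dist.
Qed.

Lemma bump_ge1 e s : 0 < e -> `|s| <= e -> 1 <= bump e s.
Proof.
move=> e0 hs; rewrite /bump le_max; apply/orP; right.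
rewrite le_min lexx /=; have : `|s| / e <= 1 by rewrite ler_pdivrMr // mul1r.
by lra.
Qed.

Lemma bump_le e s : 0 < e -> bump e s <= (`|s| <= 2 * e)%R%:R.
Proof.
move=> e0; rewrite /bump ge_max ge_min ler0n /=; case: (leP `|s| (2 * e)) => hs /=.
  by rewrite ?lexx.
by apply/orP; right; rewrite subr_le0 ler_pdivlMr // ltW.
Qed.

(** Rotating [th] by j / K leaves r alone and multiplies the other two terms of f by a K-th root of
    unity and its inverse. At each time at most two of the K rotated values are small, so f is small
    with frequency at most 2 / K plus approximation errors. *)
Lemma rare_small (r : nat -> R[i]) (w : R[i]) (f : nat -> R) (B eta : R) :
  w != 0 -> 0 < eta ->
  (forall rho, twin V th rho r r) -> (forall n, normc (r n) <= B) ->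
  (forall n, (f n)%:C = r n + w * cis (n%:R * th) + conjc w * cis (- (n%:R * th))) ->
  exists2 eps : R, 0 < eps &
    \forall n \near \oo, avg (fun i => (`|f i| <= eps)%R%:R) n <= eta.
Proof.
move=> w0 eta0 hr rB fE.
have B0 : 0 <= B := le_trans (normc_ge0 _) (rB 0%N).
(* The other three quarters of [eta] pay for the rotation and for approximating [bump] by p, once at
   f and once at the rotated values. *)
have [K K0 hK] : exists2 K : nat, (0 < K)%N & 2 / K%:R <= eta / 4.
  exists (Num.bound (8 / eta)); last first.
    have h : 8 / eta < (Num.bound (8 / eta))%:R :> R.
      by rewrite archi_boundP // divr_ge0 // ltW.
    have h0 : 0 < (Num.bound (8 / eta))%:R :> R.
      by apply: le_lt_trans h; rewrite divr_ge0 // ltW.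
    by rewrite ler_pdivrMr // mulrAC ler_pdivlMr // -ler_pdivrMl // mulrC; lra.
  rewrite -(ltr0n R); apply: le_lt_trans (archi_boundP _); rewrite ?divr_ge0 // ltW //.
pose om (j : 'I_K) : R[i] := cis (j%:R / K%:R).
have [kap kap0 hkap] := three_points (root_of_unity_inj K0) (fun j => normc_cis _).
have nw0 : 0 < normc w by rewrite lt_def normc_ge0 andbT normc_eq0.
(* Twice [eps], where [bump] reaches 0, is then the threshold of [three_points]. *)
pose eps := kap * normc w / 2.
have eps0 : 0 < eps by rewrite divr_gt0 // mulr_gt0.
exists eps => //.
pose W n (j : 'I_K) := w * cis (n%:R * th) * om j.
pose fj j n : R := complex.Re (r n) + 2 * complex.Re (W n j).
have fjE j n : (fj j n)%:C = r n + w * cis (n%:R * th) * om j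
    + conjc w * cis (- (n%:R * th)) * (om j)^-1.
  (* r is real, being f minus a sum of two conjugate numbers. *)
  have rE : r n = (complex.Re (r n))%:C.
    have -> : r n = (f n)%:C - (w * cis (n%:R * th) + conjc (w * cis (n%:R * th))).
      rewrite fE. rewrite conjcM conj_cis; ring.
    by rewrite addcJ -(rmorph_nat (real_complex R)) -rmorphM -rmorphB.
  rewrite /fj rmorphD rmorphM rmorph_nat /= -rE -addcJ /W !conjcM !conj_cis -cisN.
  by rewrite addrA /om.
pose M := B + 2 * normc w + 1.
have M0 : 0 < M by rewrite /M; lra.
have fM n : `|f n| <= M.
  rewrite -normcR fE (le_trans (le_normcD _ _)) //.
  rewrite (le_trans (lerD (le_normcD _ _) (lexx _))) //.
  rewrite !normcM !normc_cis !mulr1 normc_conj /M; have := rB n; lra.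
have fjM j n : `|fj j n| <= M.
  rewrite -normcR fjE (le_trans (le_normcD _ _)) //.
  rewrite (le_trans (lerD (le_normcD _ _) (lexx _))) //.
  rewrite !normcM normcV !normc_cis invr1 !mulr1 normc_conj /M; have := rB n; lra.
have eta4 : 0 < eta / 4 by rewrite divr_gt0.
have [p hp] := lipschitz_approx M0 eta4 (bump_lipschitz eps0).
have htw (j : 'I_K) :
    twin V th (j%:R / K%:R) (fun n => (f n)%:C) (fun n => (fj j n)%:C).
  have t1 := twin_cis th (j%:R / K%:R) 1 V0.
  have t2 := twin_cis th (j%:R / K%:R) (-1) V0.
  have := twinD (twinD (hr (j%:R / K%:R)) (twinZ w t1)) (twinZ (conjc w) t2).
  rewrite !mulN1r !mul1r !addr0 cisN; apply: twin_ext => n.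
    by rewrite fE mulrN.
  by rewrite fjE mulrN -/(om j); ring.
have := rotation_avg V0 VD V_free p K0 eta4 htw.
apply: filterS => n h.
have h1 : avg (fun i => (`|f i| <= eps)%R%:R) n <= avg (fun i => p.[f i] + eta / 4) n.
  apply: le_avg => i; have := hp _ (fM i); rewrite ler_norml => /andP[h' _].
  have [hle|_] := leP `|f i| eps; first by rewrite mulr1n; have := bump_ge1 eps0 hle; lra.
  have : 0 <= bump eps (f i) by rewrite le_max lexx.
  by rewrite mulr0n; lra.
have h2 : avg (fun i => K%:R^-1 * \sum_j p.[fj j i]) n
    <= avg (fun=> eta / 4 + eta / 4) n.
  apply: le_avg => i.
  have K0' : 0 < K%:R :> R by rewrite ltr0n.
  have : \sum_j p.[fj j i] <= \sum_j ((`|fj j i| <= 2 * eps)%R%:R + eta / 4).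
    apply: ler_sum => j _; have := hp _ (fjM j i); rewrite ler_norml => /andP[_ h'].
    by have := bump_le (fj j i) eps0; lra.
  pose A := [pred j : 'I_K | `|fj j i| <= 2 * eps].
  have -> : \sum_j ((`|fj j i| <= 2 * eps)%R%:R + eta / 4) = #|A|%:R + eta / 4 *+ K.
    rewrite big_split /= sumr_const card_ord -natr_sum -sum1_card.
    by congr (_%:R + _); rewrite [RHS]big_mkcond; apply: eq_bigr => j _; case: ifP; rewrite inE => ->.
  set c := #|A|; have c2 : (c <= 2)%N.
    have := hkap (r i) (w * cis (i%:R * th)) (conjc w * cis (- (i%:R * th))) _.
    rewrite mulf_neq0 // ?cis_neq0 // => /(_ isT); apply: leq_trans.
    apply: subset_leq_card; apply/fintype.subsetP => j; rewrite !inE.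
    have -> : 2 * eps = kap * normc w by rewrite /eps; field.
    by rewrite -normcR fjE (normcM w) normc_cis mulr1.
  move=> hs; rewrite ler_pdivrMl // (le_trans hs) //.
  have c2' : c%:R <= 2 :> R by rewrite ler_nat.
  rewrite mulrDr -[_ *+ K]mulr_natl lerD2r (le_trans c2') //.
  by rewrite mulrC -ler_pdivrMr.
have h3 := le_avg_const n (ltW eta4).
have h4 : avg (fun=> eta / 4 + eta / 4) n <= eta / 4 + eta / 4.
  by apply: le_avg_const; lra.
rewrite avgD in h1; lra.
Qed.

End SmallValues.

(** * Equally spaced points in an arc *)

Section Arcs.
Variable R : realType.

(** The cosine inequality encodes that v lies, modulo 1, in the arc of length tau centred at 0. The
    integer nearest to v is the floor of v + 1/2, and cos is decreasing on [0, pi]. *)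
Lemma cos_arc (tau v : R) : 0 <= tau <= 1 -> cos (pi * tau) <= cos (2 * pi * v) ->
  `|v - (Num.floor (v + 2^-1))%:~R| <= tau / 2.
Proof.
move=> /andP[t0 t1].
set m := Num.floor _; set t := v - _ => h.
have ht : - 2^-1 <= t <= 2^-1.
  have h1 : m%:~R <= v + 2^-1 by rewrite ge_floor.
  have h2 : v + 2^-1 < m%:~R + 1 by have := floorD1_gt (v + 2^-1); rewrite intrD.
  by rewrite /t; apply/andP; split; lra.
have cE : cos (2 * pi * v) = cos (2 * pi * `|t|).
  have [-> _] : cis v = cis t by rewrite /t cisD cisN cis_int invr1 mulr1.
  by rewrite -cos_norm normrM (ger0_norm (_ : 0 <= 2 * pi)) // mulr_ge0 ?pi_ge0.
have pi0 := pi_gt0 R.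
have tn : `|t| <= 2^-1 by rewrite ler_norml.
move: h; rewrite cE leNgt ltr_cos ?in_itv /=.
- rewrite -leNgt => h; rewrite ler_pdivlMr // -(ler_pM2l pi0); lra.
- by rewrite !mulr_ge0 //= ?(ltW pi0) //; nra.
- by rewrite mulr_ge0 ?(ltW pi0) //=; nra.
Qed.

(** Subtracting from j the multiple of K given by the integer nearest to y + j / K yields integers
    in an interval of length K tau. They are distinct because the j are distinct modulo K, and such
    an interval has at most K tau + 1 integers. *)
Lemma card_arc (K : nat) (tau y : R) : (0 < K)%N -> 0 <= tau <= 1 ->
  #|[pred j : 'I_K | cos (pi * tau) <= cos (2 * pi * (y + j%:R / K%:R))]|%:R
    <= K%:R * tau + 1.
Proof.
move=> K0 tau01; set A := [pred j | _].
have K0' : 0 < K%:R :> R by rewrite ltr0n.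
pose a := K%:R * (- y - tau / 2); pose b := K%:R * (- y + tau / 2).
pose k (j : 'I_K) : int := (j : nat)%:Z - K%:Z * Num.floor (y + j%:R / K%:R + 2^-1).
have kP j : j \in A -> a <= (k j)%:~R <= b.
  rewrite inE => /(cos_arc tau01); set m := Num.floor _.
  rewrite /a /b /k -/m => h.
  have -> : ((j : nat)%:Z - K%:Z * m)%:~R = K%:R * (y + j%:R / K%:R - m%:~R - y) :> R.
    by rewrite rmorphB rmorphM /=; field; rewrite gt_eqF.
  by move: h; rewrite !ler_pM2l // ler_norml => /andP[h1 h2]; apply/andP; split; lra.
have k_inj : injective k.
  move=> i j; rewrite /k; set m1 := Num.floor _; set m2 := Num.floor _ => h.
  have hi := ltn_ord i; have hj := ltn_ord j; apply/val_inj => /=.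
  have {}h : (i : nat)%:Z - (j : nat)%:Z = K%:Z * (m1 - m2) by lia.
  case: (ltrgtP (m1 - m2) 0) => m0; last by move: h; rewrite m0; lia.
    by have : K%:Z * (m1 - m2) <= - K%:Z; nia.
  by have : K%:Z * (m1 - m2) >= K%:Z; nia.
have b_a : K%:R * tau = b - a by rewrite /a /b; field.
have [j0 j0A|A0] := pickP A; last first.
  rewrite (eq_card0 A0).
  by rewrite addr_ge0 // mulr_ge0 ?(ltW K0') //; case/andP: tau01.
pose N := absz (Num.floor b - Num.ceil a + 1).
have kN j : j \in A -> (Num.ceil a <= k j <= Num.floor b)%R.
  by move=> /kP /andP[h1 h2]; rewrite ceil_le_int floor_ge_int h1 h2.
have AN : (#|A| <= N)%N.
  pose g j := absz (k j - Num.ceil a).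
  rewrite cardE -(size_map g) -(size_iota 0 N) uniq_leq_size //.
    rewrite map_inj_in_uniq ?enum_uniq // => i j; rewrite !mem_enum => /kN hi /kN hj.
    by rewrite /g => h; apply: k_inj; lia.
  by move=> _ /mapP[j + ->]; rewrite mem_enum mem_iota /g /N => /kN; lia.
have /kN := j0A => hj0.
rewrite (le_trans (_ : _ <= N%:R)) ?ler_nat // b_a.
have -> : N%:R = (Num.floor b - Num.ceil a + 1)%:~R :> R.
  by rewrite -[N%:R]/((N : int)%:~R); congr (_%:~R); rewrite /N; lia.
rewrite rmorphD rmorphB /= lerD2r lerB ?ge_floor ?ceil_ge //.
Qed.

End Arcs.

(** * Lipschitz test functions and the truncated logarithm *)

Section TestFunctions.
Variable R : realType.

Lemma ln10_gt0 : 0 < ln 10 :> R.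
Proof. by rewrite ln_gt0 // ltr1n. Qed.

Lemma log10M (x y : R) : 0 < x -> 0 < y -> log10 (x * y) = log10 x + log10 y.
Proof. by move=> x0 y0; rewrite /log10 lnM ?posrE // mulrDl. Qed.

Lemma ln_lipschitz (e x y : R) : 0 < e -> e <= x -> e <= y ->
  `|ln x - ln y| <= e^-1 * `|x - y|.
Proof.
move=> e0.
have H (u v : R) : e <= u -> u <= v -> ln v - ln u <= e^-1 * (v - u).
  move=> eu uv; have u0 : 0 < u by exact: lt_le_trans eu.
  have v0 : 0 < v by exact: lt_le_trans uv.
  rewrite -ln_div ?posrE //.
  have -> : v / u = 1 + (v - u) / u by field; rewrite gt_eqF.
  have d0 : 0 <= (v - u) / u by rewrite divr_ge0 ?subr_ge0 // ltW.
  rewrite (le_trans (le_ln1Dx _)) //; first by rewrite (lt_le_trans _ d0).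
  by rewrite mulrC ler_wpM2r ?subr_ge0 // lef_pV2.
move=> ex ey; case: (leP x y) => xy.
  rewrite distrC [ `|x - y| ]distrC ger0_norm; last first.
    by rewrite subr_ge0 ler_ln ?posrE // ?(lt_le_trans e0) // (le_trans ex).
  by rewrite [ `|y - x| ]ger0_norm ?subr_ge0 // H.
rewrite ger0_norm; last first.
  by rewrite subr_ge0 ler_ln ?posrE ?(lt_le_trans e0) // ltW.
by rewrite [ `|x - y| ]ger0_norm ?subr_ge0 ?(ltW xy) // H // ltW.
Qed.

(* Constant below [e / 2], so that it is Lipschitz. *)
Definition log_floor (e s : R) := log10 (Num.max `|s| (e / 2)).

Lemma log_floor_lipschitz e s t : 0 < e ->
  `|log_floor e s - log_floor e t| <= 2 / (e * ln 10) * `|s - t|.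
Proof.
move=> e0; have l0 := ln10_gt0; have e2 : 0 < e / 2 by rewrite divr_gt0.
rewrite /log_floor /log10 -mulrBl normrM (ger0_norm (_ : 0 <= (ln 10)^-1)); last first.
  by rewrite invr_ge0 ltW.
have -> : 2 / (e * ln 10) * `|s - t| = (e / 2)^-1 * `|s - t| / ln 10.
  by field; rewrite !gt_eqF.
rewrite ler_pM2r ?invr_gt0 //.
apply: le_trans (ln_lipschitz e2 _ _) _; rewrite ?le_max ?lexx ?orbT //.
rewrite ler_pM2l ?invr_gt0 //; apply: le_trans (ler_dist_dist s t).
have h1 := ler_norm (`|s| - `|t|); have h2 := ler_norm (`|t| - `|s|).
rewrite distrC in h2.
rewrite ler_norml /Num.max; case: (ltP `|s| (e / 2)) => ?; case: (ltP `|t| (e / 2)) => ?.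
all: by apply/andP; split; lra.
Qed.

(** A ramp from 0 at c - 2 g to 1 at c - g; the margin g below c absorbs an error g in s. *)
Definition step (c g s : R) : R := Num.max 0 (Num.min 1 ((s - (c - 2 * g)) / g)).

Lemma step_lipschitz c g : 0 < g ->
  forall s t, `|step c g s - step c g t| <= g^-1 * `|s - t|.
Proof.
move=> g0 s t; apply: le_trans (maxmin_lipschitz _ _) _.
have -> : (s - (c - 2 * g)) / g - (t - (c - 2 * g)) / g = g^-1 * (s - t) by ring.
by rewrite normrM ger0_norm // invr_ge0 ltW.
Qed.

Lemma step_eq1 c g s : 0 < g -> c - g <= s -> 1 <= step c g s.
Proof.
move=> g0 h; rewrite le_max le_min lexx /= ler_pdivlMr // mul1r.
by apply/orP; right; lra.
Qed.

Lemma step_le c g s : 0 < g -> step c g s <= (c - 2 * g <= s)%R%:R.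
Proof.
move=> g0; rewrite /step ge_max ge_min ler0n /=.
case: (leP (c - 2 * g) s) => h /=; first by rewrite ?lexx.
by apply/orP; right; rewrite pmulr_lle0 ?invr_gt0 // subr_le0 ltW.
Qed.

Lemma step_ge0 c g s : 0 <= step c g s.
Proof. by rewrite le_max lexx. Qed.

Lemma avg_pred_le1 (P : pred nat) n : avg (fun i => (P i)%:R : R) n <= 1.
Proof.
apply: le_trans (le_avg_const n (@ler01 R)); apply: le_avg => i.
by case: (P i).
Qed.

End TestFunctions.

(** * The density of log |x_n| modulo 1 in an arc *)

Section ArcDensity.
Variables (R : realType) (V : set R) (alpha : R).
Hypothesis V0 : V 0.
Hypothesis VD : forall x y, V x -> V y -> V (x + y).
Hypothesis V_free : forall (h : int) (q : R) (m : int),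
  V q -> h%:~R * alpha + q = m%:~R -> h = 0.
Variables (A f delta x : nat -> R) (B : R).
Hypothesis A_gt0 : forall n, 0 < A n.
Hypothesis A_ratio : (log10 (A n.+1) - log10 (A n)) @[n --> \oo] --> alpha.
Hypothesis f_twin : forall rho,
  twin V alpha rho (fun n => (f n)%:C) (fun n => (f n)%:C).
Hypothesis f_bound : forall n, `|f n| <= B.
Hypothesis f_rare : forall eta : R, 0 < eta -> exists2 eps : R, 0 < eps &
  \forall n \near \oo, avg (fun i => (`|f i| <= eps)%R%:R) n <= eta.
Hypothesis delta_cvg0 : delta @ \oo --> (0 : R).
Hypothesis xE : forall n, x n = A n * (f n + delta n).

Let u n : R[i] := cis (log10 (A n)).

(** The boolean chooses a sign, so that one statement serves [u] and its conjugate; both are needed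
    to take real parts. *)
Lemma log10_cis_quasi (s : bool) :
  vanish (fun n => cis ((-1) ^+ s * log10 (A n.+1)) -
    cis (((-1) ^+ s : int)%:~R * alpha + 0) * cis ((-1) ^+ s * log10 (A n))).
Proof.
apply: (@vanish_le _ _ (fun n => 2 * pi * `|log10 (A n.+1) - log10 (A n) - alpha|)).
  apply: nearW => n; rewrite -cisD (le_trans (cis_lipschitz _ _)) //.
  rewrite addr0 (_ : ((-1) ^+ s : int)%:~R = (-1) ^+ s :> R); last by case: s.
  rewrite -mulrDr -mulrBr normrM normrX normrN1 expr1n mul1r.
  by rewrite opprD addrA addrAC.
rewrite -(mulr0 (2 * pi)); apply: cvgM; first exact: cvg_cst.
rewrite -(@normr0 _ R); apply: cvg_norm; rewrite -(subrr alpha).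
by apply: cvgB => //; exact: cvg_cst.
Qed.

Lemma twin_amplitude rho (s : bool) :
  twin V alpha rho (fun n => cis ((-1) ^+ s * log10 (A n)))
    (fun n => cis ((-1) ^+ s * rho) * cis ((-1) ^+ s * log10 (A n))).
Proof.
have e : ((-1) ^+ s : int)%:~R = (-1) ^+ s :> R by case: s.
have := @twin_char _ V alpha rho ((-1) ^+ s) 0
  (fun n => cis ((-1) ^+ s * log10 (A n))) V0 _ (log10_cis_quasi s).
by rewrite e; apply=> n; rewrite normc_cis.
Qed.

Lemma twin_poly_of_f rho (p : {poly R}) :
  twin V alpha rho (fun n => (p.[f n])%:C) (fun n => (p.[f n])%:C).
Proof.
have := twin_horner V0 VD (map_poly (real_complex R) p) (f_twin rho).
by apply: twin_ext => n; rewrite horner_map.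
Qed.

(** Off a rare set of times, cis (log |x_n|) is close to cis (log A_n) P (f_n) with P polynomial.
    Rotating [alpha] by j / K acts on the amplitude alone and so shifts log |x_n| by j / K; of the K
    shifted points at most K tau' + 1 lie in an arc of length tau'. *)
Lemma arc_density (x0 tau eta : R) : 0 <= tau -> 0 < eta ->
  \forall n \near \oo,
    avg (fun i => (cos (pi * tau) <= cos (2 * pi * (log10 `|x i| - x0)))%R%:R) n
      <= tau + eta.
Proof.
move=> tau0 eta0; have [tau1|tau1] := leP 1 tau.
  by apply: nearW => n; rewrite (le_trans (avg_pred_le1 _ _ _)) //; lra.
set c := cos (pi * tau).
have pi0 := pi_gt0 R.
(* A slightly longer arc leaves room between the two cosines for the approximations. *)
pose tau' := Num.min 1 (tau + eta / 4).
have t1' : tau' <= 1 by rewrite ge_min lexx.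
have tt' : tau < tau' by rewrite lt_min tau1 /=; lra.
have t'e : tau' <= tau + eta / 4 by rewrite ge_min lexx orbT.
have cc : cos (pi * tau') < c.
  have in_0pi (t : R) : 0 <= t -> t <= 1 -> pi * t \in `[0, pi]%R.
    move=> t0 t1; rewrite in_itv /=; apply/andP.
    by split; [exact: mulr_ge0 (ltW pi0) t0 | nra].
  by rewrite ltr_cos ?in_0pi ?ltr_pM2l // ltW // (le_lt_trans tau0).
(* One g is the error of [z] as an approximation of the cosine, two are the distance from c down to
   the foot of [step c g]. A positive step thus forces the cosine above cos (pi tau'). *)
pose g := (c - cos (pi * tau')) / 3.
have g0 : 0 < g by rewrite divr_gt0 // subr_gt0.
have cE : c - 3 * g = cos (pi * tau') by rewrite /g; field.
have g1 : g <= 1.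
  by have := cos_le1 (pi * tau); have := cos_geN1 (pi * tau'); rewrite -/c /g; lra.
clearbody g tau'.
(* Eight errors [e1] will occur: the bad times cost two, in each of two estimates, the polynomial p
   one, also twice, and the rotation and 1 / K one each. With tau' this makes at most tau + 3 eta /
   4. *)
have [e1 e10 e1E] : exists2 e1 : R, 0 < e1 & e1 = eta / 16.
  by exists (eta / 16) => //; rewrite divr_gt0.
have [eps eps0 heps] := f_rare e10.
have l0 := ln10_gt0 R.
have [L L0 LE] : exists2 L : R, 0 < L & L = 2 / (eps * ln 10).
  by exists (2 / (eps * ln 10)) => //; rewrite divr_gt0 // mulr_gt0.
(* The first bound keeps |f + delta| above eps / 2, where [log_floor] is the true logarithm. The
   second makes delta move [cis (log_floor _ _)] by at most g / 2. *)
pose d0 := Num.min (eps / 2) (g / (4 * pi * L)).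
have d00 : 0 < d0.
  have pL : 0 < 4 * pi * L by apply: mulr_gt0 => //; exact: mulr_gt0.
  by rewrite lt_min; apply/andP; split; rewrite divr_gt0.
pose bad i := (`|f i| <= eps) || (d0 < `|delta i|).
have badE : \forall n \near \oo, avg (fun i => (bad i)%:R) n <= e1 + e1.
  have : avg (fun i => (d0 < `|delta i|)%R%:R : R) @ \oo --> (0 : R).
    apply: cvg_avg; apply/cvgr0Pnorm_le => e e0.
    have : \forall n \near \oo, `|delta n| <= d0 by exact: (cvgr0_norm_le delta).
    by apply: filterS => n h; rewrite ltNge h /= normr0 ltW.
  move=> /cvgr0_norm_le /(_ e1 e10); move: heps; apply: filterS2 => n h1 h2.
  apply: le_trans (lerD h1 (le_trans (ler_norm _) h2)); rewrite -avgD.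
  apply: le_avg => i; rewrite /bad; case: (`|f i| <= eps); case: (d0 < `|delta i|) => /=.
  all: rewrite ?mulr1n ?mulr0n ?addr0 ?add0r ?lerDl ?lexx ?ler01 //.
(* [PR + i PI] approximates [s |-> cis (log10 |s|)] away from 0 *)
have g4 : 0 < g / 4 by rewrite divr_gt0.
have B1 : 0 < `|B| + 1 by rewrite ltr_wpDl.
have comp_lip (F : R -> R) : (forall s t, `|F s - F t| <= `|s - t|) ->
    forall s t, `|F (2 * pi * log_floor eps s) - F (2 * pi * log_floor eps t)|
      <= 2 * pi * L * `|s - t|.
  move=> hF s t; rewrite (le_trans (hF _ _)) // -mulrBr normrM.
  rewrite (ger0_norm (_ : 0 <= 2 * pi)) ?mulr_ge0 ?(ltW pi0) //.
  by rewrite -[leRHS]mulrA ler_pM2l ?mulr_gt0 // LE log_floor_lipschitz.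
have [PR hPR] := lipschitz_approx B1 g4 (comp_lip _ (@cos_lipschitz R)).
have [PI hPI] := lipschitz_approx B1 g4 (comp_lip _ (@sin_lipschitz R)).
pose P s : R[i] := PR.[s] +i* PI.[s].
have Papprox i : normc (P (f i) - cis (log_floor eps (f i))) <= g / 2.
  have fB : `|f i| <= `|B| + 1.
    by rewrite (le_trans (f_bound i)) // (le_trans (ler_norm _)) // lerDl.
  rewrite (le_trans (normc_IR _)) //= [leRHS](_ : _ = g / 4 + g / 4); last by field.
  by rewrite lerD // ?hPR ?hPI.
pose z (rho : R) i := complex.Re (cis (rho - x0) * u i * P (f i)).
(* Writing the real part as half a number plus its conjugate makes [z] a polynomial expression in
   sequences that have twins. *)
have zE rho i : (z rho i)%:C = 2^-1 * (cis (rho - x0) * u i * P (f i)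
    + cis (x0 - rho) * cis (- log10 (A i)) * (PR.[f i] -i* PI.[f i])).
  rewrite /z ReJ_add mulrC; congr (_ * (_ + _)).
  by rewrite !conjcM !conj_cis opprB.
have z2 rho i : `|z rho i| <= 2.
  rewrite (le_trans (normc_Re _)) // !normcM !normc_cis !mul1r.
  rewrite -[P _](subrK (cis (log_floor eps (f i)))) (le_trans (le_normcD _ _)) //.
  by rewrite normc_cis; have := Papprox i; lra.
have zgood rho i : ~~ bad i ->
    `|z rho i - cos (2 * pi * (log10 `|x i| - x0 + rho))| <= g.
  rewrite negb_or -leNgt -ltNge => /andP[hf hd].
  have hd1 : `|delta i| <= eps / 2 by rewrite (le_trans hd) // ge_min lexx.
  have hd2 : `|delta i| <= g / (4 * pi * L).
    by rewrite (le_trans hd) // ge_min lexx orbT.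
  have hfd : eps / 2 <= `|f i + delta i|.
    by have := lerB_normD (f i) (delta i); lra.
  have -> : cos (2 * pi * (log10 `|x i| - x0 + rho)) =
      complex.Re (cis (rho - x0) * u i * cis (log_floor eps (f i + delta i))).
    rewrite -!cisD /= /log_floor (max_idPl hfd); congr (cos (_ * _)).
    rewrite xE normrM (gtr0_norm (A_gt0 i)) log10M //; last first.
      by rewrite (lt_le_trans _ hfd) // divr_gt0.
    by ring.
  rewrite /z -ReB -mulrBr (le_trans (normc_Re _)) // !normcM !normc_cis !mul1r.
  set G := cis (log_floor eps (f i + delta i)); set G' := cis (log_floor eps (f i)).
  have -> : P (f i) - G = (P (f i) - G') + (G' - G) by ring.
  rewrite (le_trans (le_normcD _ _)) // [leRHS](_ : _ = g / 2 + g / 2); last by field.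
  rewrite lerD // (le_trans (cis_lipschitz _ _)) //.
  rewrite (le_trans (ler_wpM2l _ (log_floor_lipschitz _ _ eps0))) //.
    by rewrite mulr_ge0 ?(ltW pi0).
  rewrite -LE opprD addNKr normrN.
  apply: le_trans (_ : 2 * pi * (L * (g / (4 * pi * L))) <= _).
    by rewrite ler_pM2l ?mulr_gt0 // ler_pM2l.
  have cancel (q : R) : 0 < q -> 2 * q * (L * (g / (4 * q * L))) = g / 2.
    by move=> q0; field; rewrite !gt_eqF.
  by rewrite cancel.
have [K K0 hK] : exists2 K : nat, (0 < K)%N & K%:R^-1 <= e1.
  exists (Num.bound e1^-1).
    rewrite -(ltr0n R); apply: le_lt_trans (archi_boundP _); rewrite ?invr_ge0 ltW //.
  have b0 : 0 <= e1^-1 by rewrite invr_ge0 ltW.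
  rewrite invf_ple ?posrE ?(ltW (archi_boundP b0)) //.
have K0' : 0 < K%:R :> R by rewrite ltr0n.
have [p hp] := lipschitz_approx (ltr0n R 2) e10 (step_lipschitz c g0).
have htw (j : 'I_K) : twin V alpha (j%:R / K%:R)
    (fun n => (z 0 n)%:C) (fun n => (z (j%:R / K%:R) n)%:C).
  set rho := j%:R / K%:R.
  have t1 := twin_amplitude rho false; have t2 := twin_amplitude rho true.
  have tP : twin V alpha rho (fun n => P (f n)) (fun n => P (f n)).
    have := twinD (twin_poly_of_f rho PR) (twinZ 'i%C (twin_poly_of_f rho PI)).
    by apply: twin_ext => n; rewrite /P [RHS]complexE.
  have tQ : twin V alpha rho (fun n => PR.[f n] -i* PI.[f n])
      (fun n => PR.[f n] -i* PI.[f n]).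
    have := twinD (twin_poly_of_f rho PR) (twinZ (- 'i%C) (twin_poly_of_f rho PI)).
    by apply: twin_ext => n; rewrite [RHS]complexE /= rmorphN mulrN mulNr.
  have := twinZ 2^-1 (twinD (twinZ (cis (- x0)) (twinM VD t1 tP))
     (twinZ (cis x0) (twinM VD t2 tQ))).
  rewrite !expr0 !expr1; apply: twin_ext => n; rewrite zE /u.
    by rewrite !mul1r !mulN1r sub0r subr0 !mulrA.
  by rewrite !mul1r !mulN1r !cisD; ring.
have := rotation_avg V0 VD V_free p K0 e10 htw.
move: badE; apply: filterS2 => n hbad hrot.
have h1 : avg (fun i => (c <= cos (2 * pi * (log10 `|x i| - x0)))%R%:R) n <=
    avg (fun i => (bad i)%:R + (p.[z 0 i] + e1)) n.
  apply: le_avg => i; have := hp _ (z2 0 i); rewrite ler_norml => /andP[h' _].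
  have s0 := step_ge0 c g (z 0 i).
  have [_|gd] := boolP (bad i).
    by rewrite mulr1n; case: (c <= _); rewrite ?mulr1n ?mulr0n; lra.
  rewrite mulr0n add0r; case: (leP c _) => hc; rewrite ?mulr1n ?mulr0n; last by lra.
  have := zgood 0 i gd; rewrite addr0 ler_norml => /andP[h2 _].
  have : 1 <= step c g (z 0 i) by apply: step_eq1 => //; lra.
  by lra.
have h2 : avg (fun i => K%:R^-1 * \sum_(j < K) p.[z (j%:R / K%:R) i]) n
    (* At a bad time the trivial bound 1 on the steps is used; at a good time the points with a
       positive step are counted by [card_arc], whose extra 1 becomes 1 / K. *)
    <= avg (fun i => (bad i)%:R + (tau' + e1 + e1)) n.
  apply: le_avg => i.
  have step1 : \sum_(j < K) p.[z (j%:R / K%:R) i] <=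
      \sum_(j < K) (step c g (z (j%:R / K%:R) i) + e1).
    apply: ler_sum => j _; have := hp _ (z2 (j%:R / K%:R) i).
    by rewrite ler_norml => /andP[_ ?]; lra.
  rewrite ler_pdivrMl // (le_trans step1) // big_split /= sumr_const card_ord.
  rewrite -[e1 *+ K]mulr_natl.
  suff : \sum_(j < K) step c g (z (j%:R / K%:R) i) <= K%:R * ((bad i)%:R + (tau' + e1)).
    by rewrite !mulrDr; lra.
  have [_|gd] := boolP (bad i).
    apply: le_trans (_ : \sum_(j < K) 1 <= _).
      apply: ler_sum => j _; apply: le_trans (step_le _ _ g0) _.
      by case: (c - 2 * g <= _).
    rewrite sumr_const card_ord -mulr_natr mul1r ler_peMr ?(ltW K0') //.
    by rewrite mulr1n; lra.
  rewrite mulr0n add0r.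
  pose Ar := [pred j : 'I_K |
    cos (pi * tau') <= cos (2 * pi * (log10 `|x i| - x0 + j%:R / K%:R))].
  apply: le_trans (_ : #|Ar|%:R <= _).
    rewrite -sum1_card natr_sum [leRHS]big_mkcond; apply: ler_sum => j _.
    apply: le_trans (step_le _ _ g0) _.
    case: (leP (c - 2 * g) _) => hz; last by case: ifP.
    rewrite inE ifT // -cE.
    by have := zgood (j%:R / K%:R) i gd; rewrite ler_norml => /andP[_ ?]; lra.
  have tau'01 : 0 <= tau' <= 1 by rewrite t1' andbT; lra.
  rewrite (le_trans (card_arc _ K0 tau'01)) // mulrDr lerD2l.
  by rewrite -ler_pdivrMl // mulr1.
have h3 := le_avg_const n (ltW e10).
have h4 : avg (fun=> tau' + e1 + e1) n <= tau' + e1 + e1.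
  by apply: le_avg_const; lra.
by rewrite 2!avgD in h1; rewrite avgD in h2; lra.
Qed.

End ArcDensity.

(** * From arcs to significands *)

Section Significand.
Variable R : realType.
Implicit Types r s t tau v : R.

Lemma exp10E (k : int) : 10 ^ k = expR (k%:~R * ln 10) :> R.
Proof. by rewrite -powR_intmul // /powR pnatr_eq0. Qed.

Lemma significandP r : 0 < r ->
  1 <= significand r < 10 /\ exists k : int, r = 10 ^ k * significand r.
Proof.
move=> r0; have l0 := ln10_gt0 R.
apply: (@xgetPex _ 0 [set s : R | 1 <= s < 10 /\ exists k : int, r = 10 ^ k * s]).
set k := Num.floor (log10 r).
have k1 : k%:~R <= log10 r by rewrite ge_floor.
have k2 : log10 r < k%:~R + 1 by have := floorD1_gt (log10 r); rewrite intrD.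
exists (expR ((log10 r - k%:~R) * ln 10)); split.
  rewrite -[X in X <= _]expR0 ler_expR mulr_ge0 ?subr_ge0 ?(ltW l0) //=.
  have h10 : expR (ln 10) = 10 :> R by rewrite lnK ?posrE.
  rewrite -[ltRHS]h10 ltr_expR -[ltRHS]mul1r ltr_pM2r //; lra.
exists k; rewrite exp10E -expRD -mulrDl addrC subrK /log10 divfK ?gt_eqF //.
by rewrite lnK.
Qed.

Lemma log10_significand r : 0 < r ->
  exists k : int, log10 r = k%:~R + log10 (significand r).
Proof.
move=> r0; have [/andP[s1 _] [k rE]] := significandP r0.
have s0 : 0 < significand r by exact: lt_le_trans s1.
exists k; rewrite [in LHS]rE log10M // exp10E ?expR_gt0 //.
by rewrite {1}/log10 expRK mulfK // gt_eqF // ln10_gt0.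
Qed.

Lemma log10_01 r : 1 <= r < 10 -> 0 <= log10 r < 1.
Proof.
move=> /andP[r1 r10]; have r0 : 0 < r by exact: lt_le_trans r1.
have l0 := ln10_gt0 R.
rewrite /log10; apply/andP; split; first exact: divr_ge0 (ln_ge0 r1) (ltW l0).
by rewrite ltr_pdivrMr // mul1r ltr_ln ?posrE.
Qed.

Lemma cos_anti a b : 0 <= a -> a <= b -> b <= pi -> cos b <= cos a :> R.
Proof.
move=> a0 ab bp; have ha : 0 <= a <= pi by rewrite a0 (le_trans ab).
have hb : 0 <= b <= pi by rewrite (le_trans a0).
by rewrite leNgt ltr_cos -?leNgt // in_itv.
Qed.

Lemma cos_arc_in tau v : 0 <= v -> v <= tau -> tau <= 1 ->
  cos (pi * tau) <= cos (2 * pi * (v - tau / 2)).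
Proof.
move=> v0 vt t1; have p0 := pi_gt0 R.
rewrite -(cos_norm (2 * pi * _)); apply: cos_anti => //; last first.
  by rewrite -[leRHS]mulr1 ler_pM2l.
rewrite normrM (ger0_norm (_ : 0 <= 2 * pi)) ?mulr_ge0 ?(ltW p0) //.
have : `|v - tau / 2| <= tau / 2 by rewrite ler_norml; apply/andP; split; lra.
by nra.
Qed.

(** Here v - tau / 2 lies between tau / 2 and 1 - tau / 2; an angle beyond pi is reflected to 2 pi
    minus itself. *)
Lemma cos_arc_out tau v : 0 <= tau -> tau <= v -> v <= 1 ->
  cos (2 * pi * (v - tau / 2)) <= cos (pi * tau).
Proof.
move=> t0 tv v1; have p0 := pi_gt0 R.
have pt : 0 <= pi * tau by rewrite mulr_ge0 // ltW.
have [h|h] := leP (2 * pi * (v - tau / 2)) pi.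
  by apply: cos_anti => //; nra.
rewrite -(cosN (2 * pi * _)) -cosD2pi.
by apply: cos_anti => //; rewrite -mulr_natl; nra.
Qed.

Lemma significand_le r t : 0 < r -> 1 <= t < 10 ->
  (significand r <= t) = (log10 (significand r) <= log10 t).
Proof.
move=> r0 /andP[t1 _]; have [/andP[s1 _] _] := significandP r0.
have l0 := ln10_gt0 R.
by rewrite ler_pM2r ?invr_gt0 // ler_ln // posrE; [exact: lt_le_trans s1|exact: lt_le_trans t1].
Qed.

Lemma cos_int v (k : int) : cos (2 * pi * (k%:~R + v)) = cos (2 * pi * v).
Proof. by have [-> _] : cis (k%:~R + v) = cis v by rewrite cisD cis_int mul1r. Qed.

(** For nonzero x, S (|x|) <= t means that log |x| modulo 1 lies in [0, tau], an arc centred at tau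
    / 2. The upper bound for this arc and the one for the complementary arc, of length 1 - tau and
    centre tau / 2 + 1 / 2, pin down the density. The shift to x (i+1) reflects counting from 1. *)
Lemma benford_of_arcs (x : nat -> R) :
  (forall eta : R, 0 < eta -> \forall n \near \oo,
     avg (fun i => (x i.+1 == 0)%R%:R : R) n <= eta) ->
  (forall x0 tau eta : R, 0 <= tau -> 0 < eta -> \forall n \near \oo,
     avg (fun i => (cos (pi * tau) <=
         cos (2 * pi * (log10 `|x i.+1| - x0)))%R%:R : R) n <= tau + eta) ->
  benford x.
Proof.
move=> hz harc t t110; set tau := log10 t.
have /andP[tau0 tau1] : 0 <= tau < 1 by exact: log10_01.
have avgE n : (count (fun j => significand `|x j| <= t) (iota 1 n))%:R / n%:R =
    avg (fun i => (significand `|x i.+1| <= t)%R%:R : R) n :> R.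
  rewrite /avg -natr_sum; congr (_%:R / _).
  rewrite -sum1_count big_mkcond -[1%N]addn0 iotaDl big_map.
  rewrite -val_enum_ord big_map big_enum /=.
  by apply: eq_bigr => i _; rewrite add1n; case: (_ <= _)%R.
rewrite (funext avgE); apply/cvgrPdist_le => e e0.
have e2 : 0 < e / 2 by rewrite divr_gt0.
have t'0 : 0 <= 1 - tau by lra.
have dec i : x i.+1 != 0 -> exists k : int, exists v : R,
   [/\ 0 <= v, v < 1, log10 `|x i.+1| = k%:~R + v &
       (significand `|x i.+1| <= t) = (v <= tau)].
  rewrite -normr_gt0 => xi; have [k kE] := log10_significand xi.
  exists k, (log10 (significand `|x i.+1|)); split=> //.
  - by have [/log10_01 /andP[]] := significandP xi.
  - by have [/log10_01 /andP[]] := significandP xi.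
  - by rewrite significand_le.
near=> n.
have n0 : (0 < n)%N by near: n; exact: nbhs_infty_gt.
have up : avg (fun i => (significand `|x i.+1| <= t)%R%:R : R) n <= tau + e.
  (* Zero terms have significand 0 and are counted on the left, so they are added on the right. *)
  have hle : avg (fun i => (significand `|x i.+1| <= t)%R%:R : R) n <=
      avg (fun i => (x i.+1 == 0)%R%:R + (cos (pi * tau) <=
         cos (2 * pi * (log10 `|x i.+1| - tau / 2)))%R%:R) n.
    apply: le_avg => i; have [_|xi] := eqVneq (x i.+1) 0.
      rewrite mulr1n; case: (_ <= t); last by rewrite addr_ge0.
      by rewrite mulr1n lerDl ler0n.
    rewrite mulr0n add0r; have [k [v [v0 v1 -> ->]]] := dec i xi.
    case: (leP v tau) => hv; last by rewrite ler0n.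
    by rewrite -addrA cos_int cos_arc_in // ltW.
  have h1 : avg (fun i => (x i.+1 == 0)%R%:R : R) n <= e / 2.
    by near: n; exact: hz.
  have h2 : avg (fun i => (cos (pi * tau) <=
         cos (2 * pi * (log10 `|x i.+1| - tau / 2)))%R%:R : R) n <= tau + e / 2.
    by near: n; exact: harc.
  by rewrite avgD in hle; lra.
have lo : tau - e <= avg (fun i => (significand `|x i.+1| <= t)%R%:R : R) n.
  have hle : avg (fun=> 1 : R) n <= avg (fun i => (significand `|x i.+1| <= t)%R%:R +
      (cos (pi * (1 - tau)) <=
         cos (2 * pi * (log10 `|x i.+1| - (tau / 2 + 2^-1))))%R%:R) n.
    apply: le_avg => i; case: (leP (significand _) t) => hs.
      by rewrite mulr1n lerDl ler0n.
    rewrite mulr0n add0r.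
    (* A zero term cannot occur here: its significand 0 does not exceed t. *)
    have [xi|xi] := eqVneq (x i.+1) 0.
      move: hs; rewrite xi normr0 /significand xgetPN.
        by case/andP: t110 => t1 _; move=> /(le_lt_trans t1); rewrite ltNge ler01.
      move=> s [/andP[s1 _] [k /esym/eqP]]; rewrite mulf_eq0 => /orP[].
        by rewrite exp10E gt_eqF // expR_gt0.
      by move=> /eqP s0; move: s1; rewrite s0 ler10.
    have [k [v [v0 v1 kE sE]]] := dec i xi.
    have tv : tau < v by rewrite ltNge -sE -ltNge.
    rewrite kE (_ : k%:~R + v - _ = k%:~R + (v - tau / 2 - 2^-1)); last by ring.
    rewrite cos_int.
    have -> : cos (pi * (1 - tau)) = - cos (pi * tau).
      by rewrite mulrBr mulr1 -cosN opprB cosB cospi sinpi mulr0 addr0 mulrN1.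
    have -> : 2 * pi * (v - tau / 2 - 2^-1) = 2 * pi * (v - tau / 2) - pi.
      by rewrite [LHS]mulrBr; congr (_ - _); rewrite mulrAC divff ?mul1r.
    rewrite cosB cospi sinpi mulr0 addr0 mulrN1 lerN2.
    by rewrite cos_arc_out // ltW.
  have h1 : avg (fun=> 1 : R) n = 1.
    by rewrite /avg sumr_const card_ord divff // pnatr_eq0 -lt0n.
  have h2 : avg (fun i => (cos (pi * (1 - tau)) <=
         cos (2 * pi * (log10 `|x i.+1| - (tau / 2 + 2^-1))))%R%:R : R) n <= 1 - tau + e / 2.
    by near: n; exact: harc.
  by rewrite avgD h1 in hle; lra.
by rewrite ler_norml; apply/andP; split; lra.
Unshelve. all: by end_near. Qed.

End Significand.

(** * Growth of polynomials against geometric sequences *)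

Section Growth.
Variable R : realType.
Implicit Types (p : {poly R[i]}) (r : R).

Lemma normc_natr (n : nat) : normc (n%:R : R[i]) = n%:R :> R.
Proof. by rewrite -(rmorph_nat (real_complex R)) normcR ger0_norm. Qed.

Lemma cvg_inv_nat : (n%:R : R)^-1 @[n --> \oo] --> (0 : R).
Proof. by rewrite -cvg_shiftS; exact: cvg_harmonic. Qed.

Lemma cvg_scale0 (c : R) (u : nat -> R) : u @ \oo --> (0 : R) ->
  (c * u n) @[n --> \oo] --> (0 : R).
Proof. by move=> h; rewrite -(mulr0 c); apply: cvgM; first exact: cvg_cst. Qed.

(** The induction carries the bound 1 - r^n on n r^n (1 - r); it is n r^n <= 1 + r + ... + r^(n-1)
    multiplied by 1 - r. *)
Lemma natM_expr_le r n : 0 <= r < 1 -> n%:R * r ^+ n <= 1 / (1 - r).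
Proof.
move=> /andP[r0 r1]; rewrite ler_pdivlMr ?subr_gt0 //.
have : n%:R * r ^+ n * (1 - r) <= 1 - r ^+ n.
  elim: n => [|m IH]; first by rewrite !mul0r expr0 subrr.
  have rm1 : r * r ^+ m <= 1 by rewrite -exprS exprn_ile1 // ltW.
  rewrite -addn1 natrD addn1 exprS; move: IH rm1; set q := r ^+ m.
  move: (m%:R : R) => x h1 h2.
  have h3 : r * (x * q * (1 - r)) <= r * (1 - q) by rewrite ler_wpM2l.
  have h4 : 0 <= (1 - r) * (1 - r * q) by rewrite mulr_ge0 // subr_ge0 // ltW.
  by lra.
by move=> h; apply: le_trans h _; rewrite lerBlDr lerDl exprn_ge0.
Qed.

(** Split r^n into two powers of its square root: one absorbs a factor n, the other the remaining
    n^K. *)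
Lemma natX_expr_bounded (K : nat) r : 0 <= r < 1 ->
  exists B, forall n, n%:R ^+ K * r ^+ n <= B.
Proof.
elim: K r => [|K IH] r /andP[r0 r1].
  by exists 1 => n; rewrite expr0 mul1r exprn_ile1 // ltW.
have s01 : 0 <= Num.sqrt r < 1 by rewrite sqrtr_ge0 -sqrtr1 ltr_sqrt.
have [B hB] := IH _ s01; have s0 := sqrtr_ge0 r.
exists (1 / (1 - Num.sqrt r) * B) => n.
have -> : n%:R ^+ K.+1 * r ^+ n =
    (n%:R * Num.sqrt r ^+ n) * (n%:R ^+ K * Num.sqrt r ^+ n).
  by rewrite -{1}(sqr_sqrtr r0) exprS expr2 exprMn; ring.
by rewrite ler_pM ?natM_expr_le ?mulr_ge0 ?exprn_ge0 ?ler0n.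
Qed.

Lemma cvg_natX_expr (K : nat) r : 0 <= r < 1 ->
  (n%:R ^+ K * r ^+ n) @[n --> \oo] --> (0 : R).
Proof.
move=> r01; have [B hB] := natX_expr_bounded K.+1 r01.
have r0 : 0 <= r by case/andP: r01.
have hc : (B * (n%:R : R)^-1) @[n --> \oo] --> (0 : R).
  exact: cvg_scale0 cvg_inv_nat.
apply: (@squeeze_cvgr _ _ _ _ (fun=> 0) (fun n => B * n%:R^-1)) => //; last first.
  exact: cvg_cst.
near=> n; have n0 : 0 < n%:R :> R.
  by rewrite ltr0n; near: n; exact: nbhs_infty_gt.
rewrite mulr_ge0 ?exprn_ge0 ?ler0n //= ler_pdivlMr //.
by rewrite mulrAC -exprSr hB.
Unshelve. all: by end_near. Qed.

Definition norm1 p : R := \sum_(i < size p) normc p`_i.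

Lemma normc_horner_le p n : (0 < n)%N ->
  normc p.[n%:R] <= norm1 p * n%:R ^+ size p.
Proof.
move=> n0; rewrite horner_coef (le_trans (normc_sum _ _)) // mulr_suml.
apply: ler_sum => i _; rewrite normcM normcX normc_natr ler_wpM2l ?normc_ge0 //.
by rewrite ler_weXn2l ?ler1n // ltnW.
Qed.

(** D may exceed the degree of p, the limit then being 0; one D will serve several polynomials. *)
Lemma horner_asymp p D n : (size p <= D.+1)%N -> (0 < n)%N ->
  normc (p.[n%:R] / n%:R ^+ D - p`_D) <=
    (\sum_(i < D) normc p`_i) * n%:R^-1.
Proof.
move=> sp n0; have n0' : (n%:R : R[i]) != 0 by rewrite pnatr_eq0 -lt0n.
rewrite (horner_coef_wide _ sp) big_ord_recr /= mulrDl mulfK ?expf_neq0 // addrK.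
rewrite mulr_suml (le_trans (normc_sum _ _)) // mulr_suml.
apply: ler_sum => i _; rewrite -mulrA normcM ler_wpM2l ?normc_ge0 //.
have -> : n%:R ^+ D = n%:R ^+ i * n%:R ^+ (D - i.+1).+1 :> R[i].
  by rewrite -exprD; congr (_ ^+ _); have := ltn_ord i; lia.
rewrite invfM mulrA divff ?expf_neq0 // mul1r normcV normcX normc_natr.
rewrite lef_pV2 ?posrE ?exprn_gt0 ?ltr0n // -[leLHS]expr1.
by rewrite ler_weXn2l ?ler1n.
Qed.

Lemma vanish_horner_asymp p D : (size p <= D.+1)%N ->
  vanish (fun n => p.[n%:R] / n%:R ^+ D - p`_D).
Proof.
move=> sp; apply: (@vanish_le _ _ (fun n => (\sum_(i < D) normc p`_i) * n%:R^-1)).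
  near=> n; apply: horner_asymp => //; near: n; exact: nbhs_infty_gt.
exact: cvg_scale0 cvg_inv_nat.
Unshelve. all: by end_near. Qed.

Lemma vanish_horner_expr p (z : R[i]) : normc z < 1 ->
  vanish (fun n => p.[n%:R] * z ^+ n).
Proof.
move=> z1.
apply: (@vanish_le _ _ (fun n => norm1 p * (n%:R ^+ size p * normc z ^+ n))).
  near=> n; rewrite normcM normcX mulrA ler_wpM2r ?exprn_ge0 ?normc_ge0 //.
  by apply: normc_horner_le; near: n; exact: nbhs_infty_gt.
by apply: cvg_scale0; apply: cvg_natX_expr; rewrite normc_ge0.
Unshelve. all: by end_near. Qed.

Lemma vanish_sum (I : eqType) (s : seq I) (a : I -> nat -> R[i]) :
  (forall i, i \in s -> vanish (a i)) -> vanish (fun n => \sum_(i <- s) a i n).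
Proof.
elim: s => [|i s IH] h.
  by move=> e e0; apply: nearW => n; rewrite big_nil normc0 ltW.
apply: vanish_ext (vanishD (h i _) (IH _)) => [n||j js]; rewrite ?big_cons ?mem_head //.
by apply: h; rewrite in_cons js orbT.
Qed.

Lemma cvg_ln_ratio : (ln (n.+1%:R : R) - ln (n%:R : R)) @[n --> \oo] --> (0 : R).
Proof.
apply: (@squeeze_cvgr _ _ _ _ (fun=> 0) (fun n => n%:R^-1)); last first.
- exact: cvg_inv_nat.
- exact: cvg_cst.
near=> n; have n0 : 0 < n%:R :> R.
  by rewrite ltr0n; near: n; exact: nbhs_infty_gt.
have nS : n%:R <= n.+1%:R :> R by rewrite ler_nat.
have nS0 : 0 < n.+1%:R :> R by rewrite ltr0n.
apply/andP; split; first by rewrite subr_ge0 ler_ln ?posrE.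
apply: le_trans (ler_norm _) _; apply: le_trans (ln_lipschitz n0 nS (lexx _)) _.
by rewrite -natrB // subSnn normr1 mulr1.
Unshelve. all: by end_near. Qed.

Lemma vanish_Re (a : nat -> R[i]) : vanish a ->
  complex.Re (a n) @[n --> \oo] --> (0 : R).
Proof.
move=> ha; apply/cvgr0Pnorm_le => e e0; apply: filterS (ha e e0) => n.
exact: le_trans (normc_Re _).
Qed.

End Growth.

(** * Polar form and rational independence of frequencies *)

Section Frequencies.
Variable R : realType.
Implicit Types (z : R[i]) (S : seq R) (J : pred nat) (q : R).

(** The set defining [carg] is inhabited by the arc cosine of Re z / |z|, which has the right sine
    because Im z >= 0. *)
Lemma carg_polar z : z != 0 -> 0 <= complex.Im z ->
  z = (normc z)%:C * cis (carg z / (2 * pi)).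
Proof.
move=> z0 Im0; rewrite /cis twopiK /carg (negPf z0) -normcE.
have [t tP] : exists t : R, - pi < t <= pi /\ z = `|z| * (cos t +i* sin t).
  have r0 : 0 < normc z by rewrite lt_def normc_ge0 andbT normc_eq0.
  pose a := complex.Re z / normc z.
  have a1 : -1 <= a <= 1.
    by rewrite -ler_norml /a normrM normfV (gtr0_norm r0) ler_pdivrMr // mul1r normc_Re.
  exists (acos a); split.
    by rewrite acos_lepi // andbT (lt_le_trans _ (acos_ge0 a1)) // oppr_lt0 pi_gt0.
  rewrite acosK ?in_itv //= sin_acos // normcE.
  have -> : 1 - a ^+ 2 = (complex.Im z / normc z) ^+ 2.
    have e : complex.Re z ^+ 2 + complex.Im z ^+ 2 = normc z ^+ 2.
      by case: (z) => x y; rewrite sqr_sqrtr // addr_ge0 ?sqr_ge0.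
    rewrite /a !expr_div_n -[1](@divff _ (normc z ^+ 2)) ?expf_neq0 ?gt_eqF //.
    by rewrite -e; ring.
  rewrite sqrtr_sqr ger0_norm ?divr_ge0 ?(ltW r0) //.
  apply/eqP; rewrite eq_complex /= !mul0r subr0 addr0 /a.
  by rewrite !(mulrC (normc z)) !divfK ?eqxx ?gt_eqF.
by have [_ ] := @xgetPex _ 0 [set t : R | - pi < t <= pi /\ z = `|z| * (cos t +i* sin t)]
   (ex_intro _ t tP).
Qed.

(* Half-integers plus integer combinations of the [S`_j] with [J j]. *)
Definition int_span S J : set R := [set q | exists (b : int) (m : nat -> int),
  (forall j, ~~ J j -> m j = 0) /\
  q = b%:~R / 2 + \sum_(j < size S) (m j)%:~R * S`_j].

Lemma int_span0 S J : int_span S J 0.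
Proof.
exists 0, (fun=> 0); split=> //; rewrite mul0r add0r big1 // => j _.
by rewrite mul0r.
Qed.

Lemma int_spanD S J q q' : int_span S J q -> int_span S J q' ->
  int_span S J (q + q').
Proof.
move=> [b [m [hm ->]]] [b' [m' [hm' ->]]].
exists (b + b'), (fun j => m j + m' j); split=> [j hj|]; first by rewrite hm ?hm'.
rewrite rmorphD mulrDl addrACA -big_split; congr (_ + _).
by apply: eq_bigr => j _; rewrite rmorphD mulrDl.
Qed.

Lemma int_spanN S J q : int_span S J q -> int_span S J (- q).
Proof.
move=> [b [m [hm ->]]]; exists (- b), (fun j => - m j); split=> [j hj|].
  by rewrite hm // oppr0.
rewrite opprD rmorphN mulNr -sumrN; congr (_ + _).
by apply: eq_bigr => j _; rewrite rmorphN mulNr.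
Qed.

Lemma int_span_half S J (b : int) : int_span S J (b%:~R / 2).
Proof.
exists b, (fun=> 0); split=> //; rewrite big1 ?addr0 // => j _.
by rewrite mul0r.
Qed.

Lemma int_span_nth S J j : (j < size S)%N -> J j -> int_span S J S`_j.
Proof.
move=> jS Jj; exists 0, (fun k => (k == j)%:Z); split=> [k|].
  by case: eqP => // ->; rewrite Jj.
rewrite mul0r add0r (bigD1 (Ordinal jS)) //= eqxx mul1r big1 ?addr0 // => k.
by rewrite -val_eqE /= => /negPf ->; rewrite mul0r.
Qed.

Lemma rat_indep_int S (a : R) (b h : int) (m : nat -> int) :
  rationally_independent [:: 1, a & S] ->
  b%:~R + h%:~R * a + \sum_(j < size S) (m j)%:~R * S`_j = 0 ->
  h = 0 /\ forall j, (j < size S)%N -> m j = 0.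
Proof.
move=> indep e.
pose q (j : 'I_(size [:: 1, a & S])) : rat :=
  match val j with 0%N => b%:~R | 1%N => h%:~R | k.+2 => (m k)%:~R end.
have q0 : forall j, q j = 0.
  apply: indep; rewrite !big_ord_recl /= /q /=.
  rewrite !ratr_int mulr1 addrA -[RHS]e; congr (_ + _).
  by apply: eq_bigr => j _; rewrite ratr_int.
split.
  have /eqP := q0 (@Ordinal (size [:: 1, a & S]) 1 isT).
  by rewrite /q /= intr_eq0 => /eqP.
move=> j jS; have jS2 : (j.+2 < (size S).+2)%N by [].
by have /eqP := q0 (@Ordinal (size [:: 1, a & S]) j.+2 jS2); rewrite /q /= intr_eq0 => /eqP.
Qed.

(** Makes [a], later log L0, a frequency that can be rotated while all of S stays fixed. Doubling
    the relation clears the half-integers. *)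
Lemma int_span_free S (a : R) (h : int) q (n : int) :
  rationally_independent [:: 1, a & S] ->
  int_span S predT q -> h%:~R * a + q = n%:~R -> h = 0.
Proof.
move=> indep [b [m [_ ->]]] e.
have [] := @rat_indep_int S a (b - n * 2) (h * 2) (fun j => m j * 2) indep.
  rewrite (eq_bigr (fun j : 'I_(size S) => 2 * ((m j)%:~R * S`_j))); last first.
    by move=> j _; rewrite rmorphM; ring.
  rewrite -mulr_sumr; set T := \sum_(_ < _) _ in e *.
  have -> : T = n%:~R - h%:~R * a - b%:~R / 2 by rewrite -e; ring.
  by rewrite rmorphB !rmorphM /=; field.
by move=> + _; lia.
Qed.

(** Makes one element of S a frequency that can be rotated: q does not involve it, so its
    coefficient in the doubled relation is 2 h. *)
Lemma int_span_free_nth S (a : R) (j : nat) (h : int) q (n : int) :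
  rationally_independent [:: 1, a & S] -> (j < size S)%N ->
  int_span S (predC1 j) q -> h%:~R * S`_j + q = n%:~R -> h = 0.
Proof.
move=> indep jS [b [m [hm ->]]] e.
have [] := @rat_indep_int S a (b - n * 2) 0
  (fun k => (m k + h * (k == j)%:Z) * 2) indep.
  rewrite (eq_bigr (fun k : 'I_(size S) =>
     2 * ((m k)%:~R * S`_k) + 2 * (h%:~R * (k == j :> nat)%:R * S`_k))); last first.
    move=> k _; rewrite rmorphM rmorphD rmorphM /=; ring.
  rewrite big_split -!mulr_sumr /=; set T := \sum_(_ < _) _ in e *.
  rewrite (bigD1 (Ordinal jS)) //= eqxx mulr1 big1 ?addr0; last first.
    by move=> k; rewrite -val_eqE /= => /negPf ->; rewrite mulr0 mul0r.
  have -> : T = n%:~R - h%:~R * S`_j - b%:~R / 2 by rewrite -e; ring.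
  by rewrite rmorphB !rmorphM /=; field.
move=> _ /(_ j jS); rewrite eqxx hm /= ?eqxx //; lia.
Qed.

End Frequencies.

(** * The trigonometric polynomial f_n of the dominant eigenvalues *)

Section DominantPart.
Variable R : realType.
Implicit Types (z lam : R[i]).

Definition theta z : R := carg z / (2 * pi).

Lemma Re_half z : (complex.Re z)%:C = 2^-1 * z + 2^-1 * conjc z :> R[i].
Proof. by rewrite ReJ_add mulrC mulrDr. Qed.

Lemma twin_sum (V : set R) (b0 rho : R) (I : eqType) (s : seq I)
    (a b : I -> nat -> R[i]) : V 0 ->
  (forall i, i \in s -> twin V b0 rho (a i) (b i)) ->
  twin V b0 rho (fun n => \sum_(i <- s) a i n) (fun n => \sum_(i <- s) b i n).
Proof.
move=> V0; elim: s => [|i s IH] h.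
  by apply: twin_ext (twin_const b0 rho V0 0) => n; rewrite big_nil.
have hs j : j \in s -> twin V b0 rho (a j) (b j).
  by move=> js; apply: h; rewrite in_cons js orbT.
by apply: twin_ext (twinD (h i (mem_head _ _)) (IH hs)) => n; rewrite big_cons.
Qed.

(** All frequencies lie in V, that is h = 0, so the rotation fixes the sum. The real part brings in
    the opposite frequencies. *)
Lemma twin_self (V : set R) (b0 rho : R) (s : seq R[i]) (c : R[i] -> R[i]) :
  V 0 -> (forall lam, lam \in s -> V (theta lam) /\ V (- theta lam)) ->
  let g n := (\sum_(lam <- s) complex.Re (c lam * cis (n%:R * theta lam)))%:C in
  twin V b0 rho g g.
Proof.
move=> V0 hs g.
have gE n : \sum_(lam <- s) (2^-1 * c lam * cis (n%:R * theta lam) +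
    2^-1 * conjc (c lam) * cis (n%:R * - theta lam)) = g n.
  rewrite /g rmorph_sum; apply: eq_bigr => lam _ /=.
  by rewrite Re_half conjcM conj_cis mulrN !mulrA.
apply: (twin_ext gE gE); apply: twin_sum => // lam /hs [h1 h2].
have tc q : V q -> twin V b0 rho (fun n => cis (n%:R * q)) (fun n => cis (n%:R * q)).
  move=> Vq; have := twin_cis b0 rho 0 Vq.
  by apply: twin_ext => n; rewrite ?mul0r ?cis0 add0r ?mul1r.
by apply: twinD; apply: twinZ; apply: tc.
Qed.

Variables (s : seq R[i]) (L0 : R) (c : R[i] -> R[i]).
Hypothesis s_uniq : uniq s.
Hypothesis L0_gt0 : 0 < L0.
Hypothesis s_norm : forall lam, lam \in s -> normc lam = L0.
Hypothesis s_Im : forall lam, lam \in s -> 0 <= complex.Im lam.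
Hypothesis s_real : (size [seq lam <- s | complex.Im lam == 0%R] <= 1)%N.
Hypothesis c_real : forall lam, lam \in s -> complex.Im lam = 0 ->
  complex.Im (c lam) = 0.
Hypothesis c_neq0 : exists2 lam, lam \in s & c lam != 0.

Let S : seq R := enum_fset (scaled_args [fset z in s]%fset).
Hypothesis S_indep : rationally_independent [:: 1, log10 L0 & S].

Definition dominant n : R :=
  \sum_(lam <- s) complex.Re (c lam * cis (n%:R * theta lam)).

Lemma polar lam : lam \in s -> lam = L0%:C * cis (theta lam).
Proof.
move=> ls; rewrite -(s_norm ls) -carg_polar ?s_Im //.
by rewrite -normc_eq0 s_norm // gt_eqF.
Qed.

Lemma dominantE n :
  dominant n = \sum_(lam <- s) complex.Re (c lam * (lam / L0%:C) ^+ n).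
Proof.
rewrite /dominant !big_seq; apply: eq_bigr => lam ls; rewrite cis_natM.
have L0n0 : L0%:C != 0 by rewrite -normc_eq0 normcR normr_eq0 gt_eqF.
have -> // : lam / L0%:C = cis (theta lam).
by rewrite {1}(polar ls) mulrAC mulfV // mul1r.
Qed.

Lemma theta_mem lam : lam \in s -> [\/ theta lam = 0, theta lam = 1 / 2 | theta lam \in S].
Proof.
move=> ls; have [h|h] := boolP (theta lam \in [fset 0; 1 / 2]%fset).
  by move: h; rewrite !inE => /orP[] /eqP ->; [constructor 1|constructor 2].
constructor 3; rewrite /S /scaled_args; rewrite -[_ \in _]/(theta lam \in _ `\` _)%fset.
by rewrite in_fsetD h in_imfset //= !inE.
Qed.

(** The elements of [s] share the modulus [L0], so the angle determines them. *)
Lemma theta_inj : {in s &, injective theta}.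
Proof. by move=> z w hz hw h; rewrite (polar hz) (polar hw) h. Qed.

Lemma theta_span (J : pred nat) lam : lam \in s ->
  (theta lam \in S -> J (index (theta lam) S)) -> int_span S J (theta lam).
Proof.
move=> ls hJ; have [->|->|h] := theta_mem ls; first exact: int_span0.
  exact: (int_span_half S J 1).
by rewrite -(nth_index 0 h); apply: int_span_nth (hJ h); rewrite index_mem.
Qed.

Lemma dominant_bound n : `|dominant n| <= \sum_(lam <- s) normc (c lam).
Proof.
rewrite (le_trans (ler_norm_sum _ _ _)) // ler_sum // => lam _.
by rewrite (le_trans (normc_Re _)) // normcM normc_cis mulr1.
Qed.

Lemma dominant_twin rho :
  twin (int_span S predT) (log10 L0) rho
    (fun n => (dominant n)%:C) (fun n => (dominant n)%:C).
Proof.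
apply: twin_self; first exact: int_span0.
move=> lam ls; have h : int_span S predT (theta lam) by exact: theta_span.
by split=> //; exact: int_spanN.
Qed.

(** If a non-real eigenvalue has a nonzero coefficient, its angle is a free frequency with respect
    to the others and [rare_small] applies. Otherwise a single real eigenvalue contributes and |f_n|
    is a positive constant. *)
Lemma dominant_rare (eta : R) : 0 < eta -> exists2 eps : R, 0 < eps &
  \forall n \near \oo, avg (fun i => (`|dominant i| <= eps)%R%:R) n <= eta.
Proof.
move=> eta0.
have [[l1 [l1s c1 Im1]]|nA] :=
    pselect (exists lam, [/\ lam \in s, c lam != 0 & complex.Im lam != 0]).
  (* The excluded angles 0 and 1 / 2 would make the eigenvalue real. *)
  have th1S : theta l1 \in S.
    have [h|h|//] := theta_mem l1s; move: Im1.
      by rewrite (polar l1s) h cis0 mulr1 eqxx.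
    rewrite (polar l1s) h /cis (_ : 2 * pi * (1 / 2) = pi); last by field.
    by rewrite cospi sinpi /= !mulr0 mul0r addr0 eqxx.
  pose j1 := index (theta l1) S.
  have j1S : (j1 < size S)%N by rewrite index_mem.
  pose r n : R[i] := (\sum_(lam <- rem l1 s)
     complex.Re (c lam * cis (n%:R * theta lam)))%:C.
  have V0 := int_span0 S (predC1 j1).
  have VD := @int_spanD R S (predC1 j1).
  have V_free h q m : int_span S (predC1 j1) q ->
      h%:~R * theta l1 + q = m%:~R -> h = 0.
    rewrite -(nth_index 0 th1S); exact: int_span_free_nth S_indep j1S.
  apply: (rare_small V0 VD V_free (r := r) (w := 2^-1 * c l1)
    (B := \sum_(lam <- rem l1 s) normc (c lam))) => //.
  - by rewrite mulf_neq0 // invr_eq0 pnatr_eq0.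
  - move=> rho; apply: twin_self => // lam; rewrite mem_rem_uniq // inE => /andP[ll1 ls].
    have h : int_span S (predC1 j1) (theta lam).
      apply: theta_span => // thS; rewrite /= /j1.
      apply: contra ll1 => /eqP e; apply/eqP; apply: theta_inj => //.
      by rewrite -(nth_index 0 thS) e nth_index.
    by split=> //; exact: int_spanN.
  - move=> n; rewrite normcR (le_trans (ler_norm_sum _ _ _)) // ler_sum // => lam _.
    by rewrite (le_trans (normc_Re _)) // normcM normc_cis mulr1.
  - move=> n; rewrite /dominant (perm_big _ (perm_to_rem l1s)) big_cons /=.
    rewrite rmorphD /= -/(r n) Re_half !conjcM conj_cis conjc_inv conjc_nat.
    by ring.
have [l0 l0s c0] := c_neq0.
have Im_eq0 lam : lam \in s -> c lam != 0 -> complex.Im lam = 0.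
  move=> ls cl; apply/eqP; apply: contrapT => /negP h.
  by apply: nA; exists lam.
have domE n : dominant n = complex.Re (c l0 * (l0 / L0%:C) ^+ n).
  rewrite dominantE (perm_big _ (perm_to_rem l0s)) big_cons /= big_seq big1 ?addr0 //.
  move=> lam; rewrite mem_rem_uniq // inE => /andP[ll0 ls].
  have [->|cl] := eqVneq (c lam) 0; first by rewrite mul0r.
  have : (2 <= size [seq lam <- s | complex.Im lam == 0%R])%N.
    have : {subset [:: lam; l0] <= [seq lam <- s | complex.Im lam == 0%R]}.
      move=> z; rewrite !inE mem_filter => /orP[] /eqP ->.
        by rewrite ls Im_eq0 // eqxx.
      by rewrite l0s Im_eq0 // eqxx.
    by apply: uniq_leq_size; rewrite /= inE ll0.
  by move=> h; have := leq_trans h s_real.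
(* Both [c l0] and [l0 / L0] are real, so taking the real part loses nothing, and the latter has
   modulus 1. *)
have dom_norm n : `|dominant n| = normc (c l0).
  have reM z w : complex.Im z = 0 -> complex.Im w = 0 -> complex.Im (z * w) = 0.
    by case: z => a b; case: w => a' b' /= -> ->; rewrite mulr0 mul0r addr0.
  have re_norm z : complex.Im z = 0 -> `|complex.Re z| = normc z.
    by case: z => a b /= ->; rewrite expr0n addr0 sqrtr_sqr.
  have Imq : complex.Im (l0 / L0%:C) = 0.
    apply: reM; first exact: Im_eq0.
    by rewrite -fmorphV.
  have ImX : complex.Im ((l0 / L0%:C) ^+ n) = 0.
    by elim: n => [//|n IH]; rewrite exprS; exact: reM.
  rewrite domE re_norm; last by apply: reM => //; apply: c_real => //; exact: Im_eq0.
  rewrite normcM normcX normcM normcV normcR (s_norm l0s) (gtr0_norm L0_gt0).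
  by rewrite divff ?gt_eqF // expr1n mulr1.
have nc0 : 0 < normc (c l0) by rewrite lt_def normc_ge0 andbT normc_eq0.
exists (normc (c l0) / 2); first by rewrite divr_gt0.
apply: nearW => n.
have -> : (fun i => (`|dominant i| <= normc (c l0) / 2)%R%:R) = (fun=> 0 : R).
  apply: funext => i; rewrite dom_norm leNgt ltr_pdivrMr // ltr_pMr //.
  by rewrite ltr1n.
by apply: le_trans (ltW eta0); apply: le_avg_const.
Qed.

End DominantPart.

(** * Benford's law for real exponential sums *)

Section ExponentialSums.
Variable R : realType.

Lemma seq_argmax (T : eqType) (f : T -> R) (t : seq T) (y : T) : y \in t ->
  exists2 z, z \in t & forall w, w \in t -> f w <= f z.
Proof.
elim: t y => // a t IH y _.
have [t0|] := pselect (exists b, b \in t).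
  have [b /IH [z zt hz]] := t0.
  have [h|h] := leP (f a) (f z).
    by exists z => [|w]; rewrite in_cons ?zt ?orbT // => /orP[/eqP->|/hz].
  exists a => [|w]; rewrite ?mem_head // in_cons => /orP[/eqP->//|/hz hw].
  by rewrite (le_trans hw) // ltW.
move=> h; exists a => [|w]; rewrite ?mem_head // in_cons => /orP[/eqP->//|wt].
by case: h; exists w.
Qed.

(** A shift changes the average by at most 1 / n; this passes from indices starting at 0 to those
    starting at 1. *)
Lemma avg_shift (u : nat -> R) (t e : R) : (forall i, 0 <= u i <= 1) -> 0 < e ->
  (\forall n \near \oo, avg u n <= t) ->
  \forall n \near \oo, avg (fun i => u i.+1) n <= t + e.
Proof.
move=> u01 e0 ht.
have hi : \forall n \near \oo, `|(n%:R : R)^-1| <= e.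
  by apply: (cvgr0_norm_le (fun n : nat => (n%:R : R)^-1)) => //; exact: cvg_inv_nat.
move: ht hi; apply: filterS2 => n h1 h2.
rewrite -(subrK (avg u n) (avg _ n)) avgS_sub addrC lerD // (le_trans _ h2) //.
rewrite (le_trans (ler_norm _)) // normrM ler_piMl //.
have := u01 n; have := u01 0%N => /andP[? ?] /andP[? ?].
by rewrite ler_norml; apply/andP; split; lra.
Qed.

(** Unless all polynomials vanish, extract the largest modulus L0 and then the largest degree D.
    With A_n = L0^n n^D the ratio x_n / A_n is f_n + o(1), and log A_n has increments tending to log
    L0, so that [arc_density] applies. *)
Lemma exp_sum_benford (sp : seq R[i]) (p : R[i] -> {poly R[i]}) (x : nat -> R) :
  uniq sp -> (forall lam, lam \in sp -> lam != 0 /\ 0 <= complex.Im lam) ->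
  (forall lam k, lam \in sp -> complex.Im lam = 0 -> complex.Im (p lam)`_k = 0) ->
  (forall (L : {fset R[i]}) (L0 : R), L != fset0 -> {subset L <= sp} ->
    (forall z, z \in L -> `|z| = L0%:C) ->
    (#|` [fset z in L | complex.Im z == 0%R]%fset | <= 1)%N /\
    rationally_independent [:: 1, log10 L0 & enum_fset (scaled_args L)]) ->
  (forall n, x n = \sum_(lam <- sp) complex.Re ((p lam).[n%:R] * lam ^+ n)) ->
  benford x \/ forall n, x n = 0.
Proof.
move=> sp_uniq sp_ok p_real nonres xE.
have [[y [ysp yp]]|noP] := pselect (exists lam, lam \in sp /\ p lam != 0); last first.
  right=> n; rewrite xE big_seq big1 // => lam lsp.
  have [->|h] := eqVneq (p lam) 0; first by rewrite horner0 mul0r.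
  by case: noP; exists lam.
left; pose t1 := [seq lam <- sp | p lam != 0].
have [l1 l1t max1] : exists2 z, z \in t1 & forall w, w \in t1 -> normc w <= normc z.
  by apply: (@seq_argmax _ (@normc R) _ y); rewrite mem_filter yp.
pose L0 := normc l1; pose t2 := [seq lam <- t1 | normc lam == L0].
have [l2 l2t max2] : exists2 z, z \in t2 &
    forall w, w \in t2 -> (size (p w))%:R <= (size (p z))%:R :> R.
  by apply: (@seq_argmax _ (fun z => (size (p z))%:R) _ l1); rewrite mem_filter eqxx.
pose D := (size (p l2)).-1; pose c lam := (p lam)`_D.
(* Elements with [p lam = 0] are kept; their coefficient [c lam] is 0. *)
pose s := [seq lam <- sp | normc lam == L0].
have [l2sp [l2p l2n]] : l2 \in sp /\ p l2 != 0 /\ normc l2 = L0.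
  by move: l2t; rewrite !mem_filter => /andP[/eqP -> /andP[-> ->]].
have l1sp : l1 \in sp by move: l1t; rewrite mem_filter => /andP[].
have L0_gt0 : 0 < L0.
  by rewrite lt_def normc_ge0 andbT normc_eq0; have [] := sp_ok _ l1sp.
have s_uniq : uniq s by rewrite filter_uniq.
have s_sub lam : lam \in s -> lam \in sp by rewrite mem_filter => /andP[].
have s_norm lam : lam \in s -> normc lam = L0 by rewrite mem_filter => /andP[/eqP].
have s_Im lam : lam \in s -> 0 <= complex.Im lam by move=> /s_sub/sp_ok [].
have c_real lam : lam \in s -> complex.Im lam = 0 -> complex.Im (c lam) = 0.
  by move=> /s_sub ls; exact: p_real.
have l2s : l2 \in s by rewrite mem_filter l2n eqxx.
have c_neq0 : exists2 lam, lam \in s & c lam != 0.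
  by exists l2 => //; rewrite /c /D -[_`__]/(lead_coef (p l2)) lead_coef_eq0.
have [||z|cardL S_indep] := nonres [fset z in s]%fset L0.
- by apply/fset0Pn; exists l2; rewrite !inE.
- by move=> z; rewrite !inE => /s_sub.
- by rewrite !inE => /s_norm; rewrite normcE => ->.
have s_real : (size [seq lam <- s | complex.Im lam == 0%R] <= 1)%N.
  apply: leq_trans cardL; apply: uniq_leq_size; first by rewrite filter_uniq.
  by move=> z; rewrite mem_filter => /andP[h1 h2]; rewrite !inE h2 h1.
(* The maximum with 1 keeps [A 0] positive when D > 0. *)
pose f := dominant s c; pose A n : R := L0 ^+ n * (maxn n 1)%:R ^+ D.
have max_gt0 n : 0 < (maxn n 1)%:R :> R by rewrite ltr0n leq_max orbT.
have A_gt0 n : 0 < A n by rewrite mulr_gt0 // exprn_gt0.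
pose delta n := x n / A n - f n.
have xA n : x n = A n * (f n + delta n).
  by rewrite /delta addrCA subrr addr0 mulrC divfK // gt_eqF.
have L0n0 : L0%:C != 0 by rewrite -normc_eq0 normcR normr_eq0 gt_eqF.
have size_le lam : lam \in s -> (size (p lam) <= D.+1)%N.
  move=> ls; have [->|pl] := eqVneq (p lam) 0; first by rewrite size_poly0.
  rewrite /D prednK ?lt0n ?size_poly_eq0 // -(ler_nat R); apply: max2.
  by rewrite !mem_filter pl s_sub // s_norm ?eqxx.
have delta0 : delta @ \oo --> (0 : R).
  (* For n > 0, delta is the real part of the sum of these terms. On the circle of radius L0 a term
     vanishes by leading-coefficient asymptotics; inside, by geometric decay unless its polynomial
     is 0. *)
  pose term lam n : R[i] := ((p lam).[n%:R] / n%:R ^+ D -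
    (if normc lam == L0 then c lam else 0)) * (lam / L0%:C) ^+ n.
  have term0 lam : lam \in sp -> vanish (term lam).
    move=> lsp; rewrite /term; have [ln|ln] := eqVneq (normc lam) L0.
      have ls : lam \in s by rewrite mem_filter ln eqxx.
      have q1 n : normc ((lam / L0%:C) ^+ n) <= 1.
        by rewrite normcX normcM normcV normcR ln gtr0_norm // divff ?expr1n ?gt_eqF.
      apply: vanish_ext (vanish_boundedM q1 (vanish_horner_asymp (size_le _ ls))).
      by move=> n; rewrite mulrC.
    have [pl|pl] := eqVneq (p lam) 0.
      move=> e e0; apply: nearW => n.
      by rewrite pl horner0 mul0r subr0 mul0r normc0 ltW.
    have lt1 : normc (lam / L0%:C) < 1.
      rewrite normcM normcV normcR gtr0_norm // ltr_pdivrMr // mul1r lt_neqAle ln.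
      by apply: max1; rewrite mem_filter pl.
    have b1 n : normc ((n%:R ^+ D : R[i])^-1) <= 1.
      rewrite normcV normcX normc_natr; case: n => [|n].
        by case: (D) => [|m]; rewrite ?expr0 ?invr1 // exprS mul0r invr0.
      by rewrite invf_le1 ?exprn_gt0 ?ltr0n // exprn_ege1 // ler1n.
    apply: vanish_ext (vanish_boundedM b1 (vanish_horner_expr (p lam) lt1)).
    by move=> n; rewrite subr0; ring.
  have := vanish_Re (vanish_sum term0); apply: cvg_trans; apply: near_eq_cvg.
  near=> n; have n0 : (0 < n)%N by near: n; exact: nbhs_infty_gt.
  have An : (A n)%:C = L0%:C ^+ n * n%:R ^+ D.
    by rewrite /A (maxn_idPl n0) rmorphM !rmorphXn rmorph_nat.
  rewrite Re_sum /delta xE /f (dominantE c L0_gt0 s_norm s_Im) big_filter [X in _ - X]big_mkcond.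
  rewrite mulr_suml -sumrB; apply: eq_bigr => lam _ /=.
  rewrite /term mulrBl ReB; congr (_ - _); last first.
    by case: ifP => // _; rewrite mul0r.
  have AVn : ((A n)^-1)%:C = (L0%:C ^+ n * n%:R ^+ D)^-1 by rewrite -An -fmorphV.
  rewrite [RHS]mulrC -Re_realM AVn; congr complex.Re.
  by rewrite expr_div_n invfM; ring.
have A_ratio : (log10 (A n.+1) - log10 (A n)) @[n --> \oo] --> log10 L0.
  have h := cvg_scale0 (D%:R / ln 10) (@cvg_ln_ratio R).
  have : (log10 L0 + D%:R / ln 10 * (ln (n.+1%:R : R) - ln (n%:R : R)))
      @[n --> \oo] --> log10 L0.
    by rewrite -[X in _ --> X]addr0; apply: cvgD h; exact: cvg_cst.
  apply: cvg_trans; apply: near_eq_cvg; near=> n.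
  have n0 : (0 < n)%N by near: n; exact: nbhs_infty_gt.
  have n0' : 0 < n%:R :> R by rewrite ltr0n.
  rewrite /A (maxn_idPl n0) (maxn_idPl (_ : 1 <= n.+1)%N) // exprS -mulrA.
  rewrite log10M ?mulr_gt0 ?exprn_gt0 ?ltr0n // /log10.
  rewrite !lnM ?posrE ?exprn_gt0 ?ltr0n // (@lnXn _ D n.+1%:R) ?ltr0n //.
  rewrite (@lnXn _ D n%:R) //; move: (ln 10) (ln n.+1%:R) (ln n%:R) (ln (L0 ^+ n)) (ln L0).
  by move=> t u v w l; rewrite -[u *+ D]mulr_natl -[v *+ D]mulr_natl; ring.
have f_rare (eta : R) : 0 < eta -> exists2 eps : R, 0 < eps &
    \forall n \near \oo, avg (fun i => (`|f i| <= eps)%R%:R) n <= eta.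
  by apply: (dominant_rare s_uniq L0_gt0).
have f_twin := @dominant_twin R s L0 c.
have b01 (b : bool) : 0 <= (b%:R : R) <= 1 by case: b; rewrite ?lexx ?ler01.
apply: benford_of_arcs => [eta eta0|x0 tau eta tau0 eta0].
  have e3 : 0 < eta / 3 by rewrite divr_gt0.
  have -> : eta = (eta / 3 + eta / 3) + eta / 3 by field.
  apply: (@avg_shift (fun i => (x i == 0)%:R)) => //.
  have [eps eps0 heps] := f_rare _ e3.
  have : avg (fun i => (eps < `|delta i|)%R%:R : R) @ \oo --> (0 : R).
    apply: cvg_avg; apply/cvgr0Pnorm_le => e e0.
    have : \forall n \near \oo, `|delta n| <= eps by exact: (cvgr0_norm_le delta).
    by apply: filterS => n h; rewrite ltNge h /= normr0 ltW.
  move=> /cvgr0_norm_le /(_ _ e3); move: heps; apply: filterS2 => n h1 h2.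
  apply: le_trans (lerD h1 (le_trans (ler_norm _) h2)); rewrite -avgD.
  apply: le_avg => i; case: eqVneq => [xi|_]; last by rewrite addr_ge0 ?ler0n.
  (* So a zero of x forces f to be small or delta to be large, both of which are rare. *)
  have fd : `|f i| = `|delta i|.
    have /eqP := xi; rewrite xA mulf_eq0 gt_eqF //= addr_eq0 => /eqP ->.
    by rewrite normrN.
  by rewrite fd; case: leP => _; rewrite mulr1n mulr0n ?addr0 ?add0r.
have e2 : 0 < eta / 2 by rewrite divr_gt0.
have -> : tau + eta = (tau + eta / 2) + eta / 2 by field.
apply: (@avg_shift (fun i => (cos (pi * tau) <=
    cos (2 * pi * (log10 `|x i| - x0)))%R%:R)) => //.
apply: (arc_density (@int_span0 R _ predT) (@int_spanD R _ predT) _ A_gt0 A_ratio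
  f_twin (dominant_bound s c) f_rare delta0 xA) => //.
by move=> h q m; exact: int_span_free.
Unshelve. all: by end_near. Qed.

End ExponentialSums.

(** * Powers of a matrix as exponential polynomials *)

Section LinearRecurrences.
Variable R : realType.
Implicit Types (lam mu : R[i]) (p q : {poly R[i]}).

(** The action of a_(n+1) - lam a_n on a_n = q (n) mu^n, expressed on the polynomial factor. *)
Definition geom_diff lam mu q := mu *: (q \Po ('X + 1)) - lam *: q.

Lemma coef_XD1_exp n k : (('X + 1 : {poly R[i]}) ^+ n)`_k = 'C(n, k)%:R.
Proof.
elim: n k => [|n IH] k; first by rewrite expr0 coef1 bin0n.
rewrite exprSr mulrDr mulr1 coefD coefMX.
by case: k => [|k]; rewrite !IH ?bin0 ?add0r //= binS natrD addrC.
Qed.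

(** The coefficient of degree m is removed by a monomial and the size of p decreases. If mu <> lam,
    degree m suffices, with factor mu - lam. If mu = lam the operator lowers degrees by one, so
    degree m + 1 is taken, with factor lam (m + 1). *)
Lemma geom_diff_surj lam mu p : lam != 0 -> mu != 0 ->
  exists q, geom_diff lam mu q = p.
Proof.
move=> lam0 mu0; move: p.
have geomD q q' : geom_diff lam mu (q + q') = geom_diff lam mu q + geom_diff lam mu q'.
  by rewrite /geom_diff comp_polyD !scalerDr opprD addrACA.
have coefT (a : R[i]) n k : (geom_diff lam mu (a *: 'X^n))`_k =
    a * (mu * 'C(n, k)%:R - lam * (k == n)%:R).
  rewrite /geom_diff comp_polyZ comp_Xn_poly coefB !coefZ coef_XD1_exp coefXn.
  by ring.
have peel m p : (size p <= m.+1)%N ->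
    exists q, (size (p - geom_diff lam mu q)%R <= m)%N.
  move=> sp; have p0 k : (m < k)%N -> p`_k = 0.
    by move=> mk; apply: nth_default; exact: leq_trans mk.
  have [e|ne] := eqVneq mu lam.
    have m0 : (m.+1%:R : R[i]) != 0 by rewrite pnatr_eq0.
    exists ((p`_m / (lam * m.+1%:R)) *: 'X^(m.+1)); apply/leq_sizeP => k.
    rewrite coefB coefT e leq_eqVlt => /orP[/eqP <-|mk].
      by rewrite binSn ltn_eqF // mulr0 subr0 divfK ?subrr ?mulf_neq0.
    rewrite (p0 k mk); move: mk; rewrite leq_eqVlt => /orP[/eqP <-|mk].
      by rewrite binn eqxx subrr mulr0 subr0.
    by rewrite bin_small // gtn_eqF // !mulr0 subrr mulr0 subr0.
  have ml0 : mu - lam != 0 by rewrite subr_eq0.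
  exists ((p`_m / (mu - lam)) *: 'X^m); apply/leq_sizeP => k.
  rewrite coefB coefT leq_eqVlt => /orP[/eqP <-|mk].
    by rewrite binn eqxx !mulr1 divfK // subrr.
  by rewrite (p0 k mk) bin_small // gtn_eqF // !mulr0 subrr mulr0 subr0.
have : forall m p, (size p <= m)%N -> exists q, geom_diff lam mu q = p.
  elim=> [|m IH] p sp.
    exists 0; rewrite /geom_diff comp_poly0 !scaler0 subrr.
    by apply/esym/eqP; rewrite -size_poly_eq0 -leqn0.
  have [q0 hq0] := peel _ _ sp; have [q hq] := IH _ hq0.
  by exists (q + q0); rewrite geomD hq subrK.
by move=> H p; exact: (H (size p)).
Qed.

Lemma horner_geom_diff lam mu q n :
  (geom_diff lam mu q).[n%:R] = mu * q.[n.+1%:R] - lam * q.[n%:R].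
Proof.
by rewrite /geom_diff !hornerE horner_comp !hornerE -[n.+1]addn1 natrD.
Qed.

Definition exp_poly (s : seq R[i]) (a : nat -> R[i]) :=
  exists p : R[i] -> {poly R[i]},
    forall n, a n = \sum_(lam <- s) (p lam).[n%:R] * lam ^+ n.

(** Subtracting a particular solution leaves d_(n+1) = lam d_n, a geometric sequence, which is
    absorbed in the polynomial attached to [lam]. *)
Lemma exp_poly_step (s : seq R[i]) lam a : uniq s -> 0 \notin s -> lam \in s ->
  exp_poly s (fun n => a n.+1 - lam * a n) -> exp_poly s a.
Proof.
move=> s_uniq s0 ls [p hp].
have s_neq0 mu : mu \in s -> mu != 0 by apply: contraTneq => ->.
have [q hq] : exists q : R[i] -> {poly R[i]},
    forall mu, mu \in s -> geom_diff lam mu (q mu) = p mu.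
  have /choice [q hq] : forall mu, exists q : {poly R[i]},
      mu \in s -> geom_diff lam mu q = p mu.
    move=> mu; have [ms|ms] := boolP (mu \in s); last by exists 0.
    have [q hq] := geom_diff_surj (p mu) (s_neq0 _ ls) (s_neq0 _ ms).
    by exists q.
  by exists q.
pose d n := a n - \sum_(mu <- s) (q mu).[n%:R] * mu ^+ n.
have dS n : d n.+1 = lam * d n.
  have e : \sum_(mu <- s) (p mu).[n%:R] * mu ^+ n =
      (\sum_(mu <- s) (q mu).[n.+1%:R] * mu ^+ n.+1)
      - lam * \sum_(mu <- s) (q mu).[n%:R] * mu ^+ n.
    rewrite mulr_sumr -sumrB big_seq [RHS]big_seq; apply: eq_bigr => mu ms.
    by rewrite -(hq mu ms) horner_geom_diff exprS; ring.
  have -> : d n.+1 = (a n.+1 - lam * a n) + lam * a n -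
      \sum_(mu <- s) (q mu).[n.+1%:R] * mu ^+ n.+1 by rewrite subrK.
  by rewrite hp e /d; ring.
have dE n : d n = d 0%N * lam ^+ n.
  by elim: n => [|n IH]; rewrite ?expr0 ?mulr1 // dS IH exprS mulrCA.
exists (fun mu => q mu + (if mu == lam then (d 0%N)%:P else 0)) => n.
rewrite (eq_bigr (fun mu => (q mu).[n%:R] * mu ^+ n +
   (if mu == lam then d 0%N * lam ^+ n else 0))); last first.
  move=> mu _; rewrite hornerD mulrDl; congr (_ + _).
  by case: eqP => [->|_]; rewrite !hornerE ?mul0r.
rewrite big_split /= [X in _ + X](bigD1_seq lam) //= eqxx [X in _ + (_ + X)]big1 => [|mu /negPf ->//].
by rewrite addr0 -dE /d addrC subrK.
Qed.

(** Q collects the linear factors moved out of the product. Multiplying Q by X - z turns the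
    sequence into its first-order difference, which [exp_poly_step] undoes. *)
Lemma exp_poly_horner_mx d (A : 'M[R[i]]_d.+1) (i j : 'I_d.+1) (s rs : seq R[i])
    (Q : {poly R[i]}) : uniq s -> 0 \notin s -> {subset rs <= s} ->
  horner_mx A (Q * \prod_(z <- rs) ('X - z%:P)) = 0 ->
  exp_poly s (fun n => horner_mx A ('X^n * Q) i j).
Proof.
move=> s_uniq s0; elim: rs Q => [|z rs IH] Q rs_s hQ.
  exists (fun=> 0) => n; rewrite big1 => [|mu _]; last by rewrite horner0 mul0r.
  by move: hQ; rewrite big_nil mulr1 rmorphM /= => ->; rewrite mulr0 mxE.
have zs : z \in s by rewrite rs_s ?mem_head.
apply: (exp_poly_step s_uniq s0 zs).
have [] := IH (Q * ('X - z%:P)).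
- by move=> w wrs; rewrite rs_s // in_cons wrs orbT.
- by move: hQ; rewrite big_cons mulrA.
move=> p hp; exists p => n; rewrite -hp.
have -> : 'X^n * (Q * ('X - z%:P)) = 'X^(n.+1) * Q - z *: ('X^n * Q).
  by rewrite -mul_polyC exprS; ring.
have -> : horner_mx A ('X^(n.+1) * Q - z *: ('X^n * Q)) =
    horner_mx A ('X^(n.+1) * Q) - z *: horner_mx A ('X^n * Q).
  by rewrite rmorphB /= linearZ.
by rewrite [RHS]mxE [X in _ = _ + X]mxE [X in _ = _ - X]mxE.
Qed.

Lemma exp_poly_mx d (A : 'M[R[i]]_d.+1) (i j : 'I_d.+1) (s : seq R[i]) :
  uniq s -> 0 \notin s -> (forall z, root (char_poly A) z -> z \in s) ->
  exp_poly s (fun n => (A ^+ n) i j).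
Proof.
move=> s_uniq s0 hs; have [rs rsE] := closed_field_poly_normal (char_poly A).
move: rsE; rewrite (monicP (char_poly_monic A)) scale1r => rsE.
have [] := @exp_poly_horner_mx d A i j s rs 1 s_uniq s0.
- by move=> z zrs; apply: hs; rewrite rsE root_prod_XsubC.
- by rewrite mul1r -rsE Cayley_Hamilton.
move=> p hp; exists p => n; rewrite -hp mulr1 rmorphXn /=.
by rewrite horner_mx_X.
Qed.

End LinearRecurrences.

(** * Spectrum of the chain and conclusion *)

Section StochasticSpectrum.
Variable R : realType.

(** The term at a point of the lower half plane equals, in real part, a conjugated term at its
    mirror image. A real z is its own image, whence the weight 1 / 2 and the real coefficients. *)
Lemma real_exp_sum_fold (s : seq R[i]) (p : R[i] -> {poly R[i]}) :
  uniq s -> (forall z, z \in s -> conjc z \in s) ->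
  exists2 p' : R[i] -> {poly R[i]},
    (forall z k, complex.Im z = 0 -> complex.Im (p' z)`_k = 0) &
    forall n : nat, \sum_(z <- s) complex.Re ((p z).[n%:R] * z ^+ n) =
      \sum_(z <- s | 0 <= complex.Im z) complex.Re ((p' z).[n%:R] * z ^+ n).
Proof.
move=> s_uniq s_conj.
pose w (z : R[i]) : R := if complex.Im z == 0 then 2^-1 else 1.
pose pc (z : R[i]) := map_poly (@conjc R) (p (conjc z)).
exists (fun z => (w z)%:C *: (p z + pc z)) => [z k Im0|n].
  have zz : conjc z = z by case: z Im0 => a b /= ->; rewrite oppr0.
  rewrite coefZ coefD coef_map /= zz /w Im0 eqxx.
  by case: (p z)`_k => a b /=; rewrite subrr mul0r addr0 mulr0.
pose G (z : R[i]) := complex.Re ((p z).[n%:R] * z ^+ n).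
have pcE z : complex.Re ((pc z).[n%:R] * z ^+ n) = G (conjc z).
  transitivity (complex.Re (conjc ((pc z).[n%:R] * z ^+ n))); first by case: (_ * _).
  rewrite conjcM; congr (complex.Re (_ * _)); last exact: rmorphXn.
  by rewrite /pc -[in LHS](conjc_nat R n) horner_map conjcK.
have perm_s : perm_eq s (map (@conjc R) s).
  have cinj : injective (@conjc R) by exact: can_inj (@conjcK R).
  rewrite uniq_perm ?map_inj_uniq // => z; apply/idP/mapP => [zs|[y ys ->]].
    by exists (conjc z); rewrite ?conjcK ?s_conj.
  exact: s_conj.
rewrite (bigID (fun z => 0 <= complex.Im z)) /=.
rewrite [X in _ + X](perm_big _ perm_s) big_map /=.
rewrite big_mkcond [X in _ + X]big_mkcond [RHS]big_mkcond -big_split /=.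
apply: eq_bigr => z _.
have -> : complex.Im (conjc z) = - complex.Im z by case: (z).
rewrite oppr_ge0 -ltNge -/(G z) -/(G (conjc z)) hornerZ -mulrA Re_realM.
rewrite hornerD mulrDl ReD pcE -/(G z) /w.
case: ltrgtP => Im0; rewrite ?mul1r ?addr0 ?add0r //.
have zz : conjc z = z by move: Im0; case: (z) => a b /= <-; rewrite oppr0.
by rewrite zz; field.
Qed.

Lemma stochasticX d (P : 'M[R]_d.+1) n : stochastic P -> stochastic (P ^+ n).
Proof.
move=> [P0 P1]; elim: n => [|n [IH0 IH1]].
  rewrite expr0; split=> [i j|i]; first by rewrite mxE; case: eqP; rewrite ?ler01.
  rewrite (bigD1 i) //= big1 ?mxE ?eqxx ?addr0 // => j /negPf ji.
  by rewrite mxE eq_sym ji.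
rewrite exprS; split=> [i j|i].
  by rewrite mxE sumr_ge0 // => k _; rewrite mulr_ge0.
rewrite (eq_bigr (fun j => \sum_k P i k * (P ^+ n) k j)); last by move=> j _; rewrite mxE.
rewrite exchange_big /= -[RHS](P1 i); apply: eq_bigr => k _.
by rewrite -mulr_sumr IH1 mulr1.
Qed.

Lemma stochastic_le1 d (P : 'M[R]_d.+1) i j : stochastic P -> P i j <= 1.
Proof.
by move=> [P0 P1]; rewrite -(P1 i) (bigD1 j) //= lerDl sumr_ge0.
Qed.

Lemma spectrum_root d (P : 'M[R]_d.+1) z :
  spectrum P z <-> root (char_poly (map_mx (real_complex R) P)) z.
Proof. by rewrite /spectrum /= eigenvalue_root_char. Qed.

Lemma spectrum_conj d (P : 'M[R]_d.+1) z : spectrum P z -> spectrum P (conjc z).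
Proof.
rewrite !spectrum_root -map_char_poly -complex_root_conj.
rewrite -map_poly_comp => h.
rewrite (_ : map_poly _ _ = map_poly (real_complex R) (char_poly P)) //.
by apply: eq_map_poly => x; rewrite /= oppr0.
Qed.

(** Eigenvectors are row vectors here, and v P has l1 norm at most that of v because the rows of P
    sum to 1. *)
Lemma spectrum_normc_le1 d (P : 'M[R]_d.+1) z :
  stochastic P -> spectrum P z -> normc z <= 1.
Proof.
move=> [P0 P1] /eigenvalueP [v vP v0].
pose N := \sum_j normc (v 0 j).
have N0 : 0 < N.
  have [j vj] : exists j, v 0 j != 0 by apply/rV0Pn.
  rewrite /N (bigD1 j) //= ltr_pwDl //.
    by rewrite lt_def normc_ge0 andbT normc_eq0.
  by apply: sumr_ge0 => k _; exact: normc_ge0.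
rewrite -(ler_pM2r N0) mul1r {1}/N mulr_sumr.
apply: le_trans (_ : \sum_j \sum_k normc (v 0 k) * P k j <= _).
  apply: ler_sum => j _; rewrite -normcM.
  have -> : z * v 0 j = (z *: v) 0 j by rewrite mxE.
  rewrite -vP mxE (le_trans (normc_sum _ _)) // ler_sum // => k _.
  by rewrite mxE normcM normcR ger0_norm.
rewrite exchange_big /= /N; apply: ler_sum => k _.
by rewrite -mulr_sumr P1 mulr1.
Qed.

Lemma nonresonant_log10_neq0 d (P : 'M[R]_d.+1) z : nonresonant P ->
  spectrum_plus P z -> z != 1 -> log10 (normc z) != 0.
Proof.
move=> nonres zP z1; apply/eqP => l0.
have [|y /=|y|_ indep] := nonres [fset z]%fset (normc z).
- by apply/fset0Pn; exists z; rewrite inE.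
- by rewrite inE => /eqP ->; split=> //; apply/eqP.
- by rewrite inE => /eqP ->; rewrite normcE.
have [] := @rat_indep_int R _ _ 0 1 (fun=> 0) indep; last by [].
by rewrite l0 mulr0 addr0 add0r big1 // => j _; rewrite mul0r.
Qed.

(** Nonresonance of a singleton makes log |z| nonzero, which excludes |z| = 1 and also z = 0, since
    log 0 = 0. The lower half plane is reached by conjugation. *)
Lemma nonresonant_normc d (P : 'M[R]_d.+1) z : stochastic P -> nonresonant P ->
  spectrum P z -> z != 1 -> 0 < normc z < 1.
Proof.
move=> sP nonres zP z1.
have l0 : log10 (normc z) != 0.
  have [h|h] := leP 0 (complex.Im z).
    by apply: nonresonant_log10_neq0 nonres _ z1.
  rewrite -normc_conj; apply: nonresonant_log10_neq0 nonres _ _.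
    by split; [exact: spectrum_conj|case: (z) h => a b /= h; rewrite oppr_ge0 ltW].
  by apply: contra z1 => /eqP e; rewrite -(conjcK z) e conjc1.
rewrite !lt_def (spectrum_normc_le1 sP zP) normc_ge0 !andbT.
apply/andP; split; first by apply: contra l0 => /eqP ->; rewrite /log10 ln0 // mul0r.
by apply: contra l0 => /eqP <-; rewrite /log10 ln1 mul0r.
Qed.

Lemma spectrum_seq d (P : 'M[R]_d.+1) : exists2 s : seq R[i], uniq s &
  forall z, z \in s <-> spectrum P z /\ z != 1.
Proof.
have [rs] := closed_field_poly_normal (char_poly (map_mx (real_complex R) P)).
rewrite (monicP (char_poly_monic _)) scale1r => rsE.
exists [seq z <- undup rs | z != 1] => [|z]; first by rewrite filter_uniq ?undup_uniq.
rewrite mem_filter mem_undup spectrum_root rsE root_prod_XsubC.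
by split=> [/andP[]|[-> ->]].
Qed.

(** If D >= 1 is the degree, p (n) / n^D tends to the nonzero leading coefficient, yet is at most B
    / n. *)
Lemma bounded_poly_const (p : {poly R[i]}) (B : R) :
  (\forall n \near \oo, normc p.[n%:R] <= B) -> exists k, p = k%:P.
Proof.
move=> hB; have [h|h] := leqP (size p) 1; first by exists p`_0; exact: size1_polyC.
exfalso; pose D := (size p).-1.
have sp : (size p <= D.+1)%N by rewrite /D prednK // ltnW.
have D0 : (0 < D)%N by rewrite /D -ltnS prednK // ltnW.
have l0 : 0 < normc p`_D.
  rewrite lt_def normc_ge0 andbT normc_eq0 -[_`__]/(lead_coef p) lead_coef_eq0.
  by rewrite -size_poly_gt0 ltnW.
have l4 : 0 < normc p`_D / 4 by rewrite divr_gt0.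
have hi : \forall n \near \oo, `|B * (n%:R : R)^-1| <= normc p`_D / 4.
  by apply: (cvgr0_norm_le (fun n : nat => B * (n%:R : R)^-1)) => //;
     exact: cvg_scale0 (@cvg_inv_nat R).
have ha := vanish_horner_asymp sp l4.
near \oo => n.
have n0 : (0 < n)%N by near: n; exact: nbhs_infty_gt.
have h1 : normc p.[n%:R] <= B by near: n.
have h2 : `|B * (n%:R : R)^-1| <= normc p`_D / 4 by near: n.
have h3 : normc (p.[n%:R] / n%:R ^+ D - p`_D) <= normc p`_D / 4 by near: n.
have n0' : 0 < n%:R :> R by rewrite ltr0n.
have h4 : normc (p.[n%:R] / n%:R ^+ D) <= B * n%:R^-1.
  rewrite normcM normcV normcX normc_natr ler_pM ?normc_ge0 ?invr_ge0 ?exprn_ge0 //.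
  rewrite lef_pV2 ?posrE ?exprn_gt0 // -[leLHS]expr1.
  by rewrite ler_weXn2l ?ler1n.
have h5 : normc p`_D <= normc (p.[n%:R] / n%:R ^+ D - p`_D) + normc (p.[n%:R] / n%:R ^+ D).
  rewrite normcB -{1}(subrK (p.[n%:R] / n%:R ^+ D) p`_D); exact: le_normcD.
have := ler_norm (B * (n%:R : R)^-1); lra.
Unshelve. all: by end_near. Qed.

(** The polynomial attached to the eigenvalue 1 is bounded on large integers, because the entries of
    P^n lie in [0, 1] and the other terms tend to 0; hence it is constant. *)
Lemma stochastic_power_expansion d (P : 'M[R]_d.+1) (s : seq R[i]) i j :
  stochastic P -> nonresonant P -> uniq s ->
  (forall z, z \in s <-> spectrum P z /\ z != 1) ->
  exists (k : R[i]) (p : R[i] -> {poly R[i]}),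
    forall n, ((P ^+ n) i j)%:C = k + \sum_(z <- s) (p z).[n%:R] * z ^+ n.
Proof.
move=> sP nonres s_uniq sE.
have s_lt1 z : z \in s -> 0 < normc z < 1.
  by move=> /sE [zP z1]; exact: nonresonant_normc sP nonres zP z1.
have s1 : 1 \notin s by apply/negP => /sE [_]; rewrite eqxx.
have s0 : 0 \notin 1 :: s.
  rewrite in_cons eq_sym oner_eq0 /=; apply/negP => /s_lt1 /andP[].
  by rewrite normc0 ltxx.
have [||z|p hp] := @exp_poly_mx R d (map_mx (real_complex R) P) i j (1 :: s).
- by rewrite /= s1.
- exact: s0.
- rewrite -spectrum_root in_cons => zP; case: eqVneq => //= z1.
  by apply/sE.
have aE n : ((P ^+ n) i j)%:C = (p 1).[n%:R] + \sum_(z <- s) (p z).[n%:R] * z ^+ n.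
  by have := hp n; rewrite big_cons expr1n mulr1 => <-; rewrite -rmorphXn mxE.
have hs : vanish (fun n => \sum_(z <- s) (p z).[n%:R] * z ^+ n).
  by apply: vanish_sum => z /s_lt1 /andP[_]; exact: vanish_horner_expr.
have [|k hk] := @bounded_poly_const (p 1) 2; last first.
  by exists k, p => n; rewrite aE hk hornerC.
apply: filterS (hs 1 ltr01) => n hn.
rewrite -(addrK (\sum_(z <- s) (p z).[n%:R] * z ^+ n) (p 1).[_]) -aE.
rewrite (le_trans (le_normcD _ _)) // normcN normcR (_ : 2 = 1 + 1) // lerD //.
have sPn := stochasticX n sP.
by rewrite ger0_norm ?stochastic_le1 //; case: sPn.
Qed.

Lemma PstarE d (P K : 'M[R]_d.+1) :
  (forall i j, (P ^+ n) i j @[n --> \oo] --> K i j) -> Pstar P = K.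
Proof.
move=> h; apply: (@cvg_lim _ (@norm_hausdorff R 'M[R]_d.+1)).
move=> B [Q QK QB].
have : \forall n \near \oo, forall i j, Q i j ((P ^+ n) i j).
  apply: filter_forall => i; apply: filter_forall => j; exact: h (QK i j).
by apply: filterS => n hn; apply: QB.
Qed.

Lemma real_exp_sum_benford d (P : 'M[R]_d.+1) (s : seq R[i])
    (p : R[i] -> {poly R[i]}) (x : nat -> R) :
  stochastic P -> nonresonant P -> uniq s ->
  (forall z, z \in s <-> spectrum P z /\ z != 1) ->
  (forall n, x n = \sum_(z <- s) complex.Re ((p z).[n%:R] * z ^+ n)) ->
  benford x \/ eventually_zero x.
Proof.
move=> sP nonres s_uniq sE xE.
have s_conj z : z \in s -> conjc z \in s.
  move=> /sE [zP z1]; apply/sE; split; first exact: spectrum_conj.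
  by apply: contra z1 => /eqP e; rewrite -(conjcK z) e conjc1.
have [p' p'_real p'E] := real_exp_sum_fold p s_uniq s_conj.
have [||||n|bx|x0] := @exp_sum_benford R [seq z <- s | 0 <= complex.Im z] p' x.
- by rewrite filter_uniq.
- move=> z; rewrite mem_filter => /andP[Im0 /sE [zP z1]]; split=> //.
  have /andP[+ _] := nonresonant_normc sP nonres zP z1.
  by rewrite lt_def normc_eq0 => /andP[].
- by move=> z k _; exact: p'_real.
- move=> L L0 Ln0 Ls LL0; apply: nonres => // z /= /Ls.
  rewrite mem_filter => /andP[Im0 /sE [zP z1]]; split=> //.
  by move=> z1'; rewrite z1' eqxx in z1.
- by rewrite xE p'E big_filter.
- by left.
right; rewrite /eventually_zero (_ : [set _ | _] = set0); first exact: finite_set0.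
by apply/seteqP; split=> n //=; rewrite x0 eqxx.
Qed.

Lemma benford_matrix_S d (P : 'M[R]_d.+1) : stochastic P -> nonresonant P ->
  benford_matrix P.
Proof.
move=> sP nonres; have [s s_uniq sE] := spectrum_seq P.
have /choice [k hk] : forall ij : 'I_d.+1 * 'I_d.+1,
    exists k : R[i] * (R[i] -> {poly R[i]}),
    forall n, ((P ^+ n) ij.1 ij.2)%:C = k.1 + \sum_(z <- s) (k.2 z).[n%:R] * z ^+ n.
  move=> [i j]; have [k [p hp]] := stochastic_power_expansion i j sP nonres s_uniq sE.
  by exists (k, p).
have hs ij : vanish (fun n => \sum_(z <- s) ((k ij).2 z).[n%:R] * z ^+ n).
  apply: vanish_sum => z /sE [zP z1]; apply: vanish_horner_expr.
  by have /andP[] := nonresonant_normc sP nonres zP z1.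
have PE n ij : (P ^+ n) ij.1 ij.2 = complex.Re (k ij).1 +
    \sum_(z <- s) complex.Re (((k ij).2 z).[n%:R] * z ^+ n).
  by rewrite -Re_sum -ReD -hk.
have PstarK : Pstar P = \matrix_(i, j) complex.Re (k (i, j)).1.
  apply: PstarE => i j; rewrite mxE.
  rewrite (_ : (fun n => _) = fun n => complex.Re (k (i, j)).1 +
    complex.Re (\sum_(z <- s) ((k (i, j)).2 z).[n%:R] * z ^+ n)); last first.
    by apply: funext => n; rewrite Re_sum -(PE n (i, j)).
  rewrite -[X in _ --> X]addr0; apply: cvgD; first exact: cvg_cst.
  exact: vanish_Re.
move=> i j; split.
  apply: (real_exp_sum_benford (s := s) (p := (k (i, j)).2) sP nonres) => // n.
  by rewrite PstarK !mxE (PE n (i, j)) addrAC subrr add0r.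
(* The constant term cancels, and each p_z (n) z^n is replaced by its forward difference, which is
   [geom_diff] with lam = 1 and mu = z. *)
apply: (real_exp_sum_benford (s := s)
  (p := fun z => geom_diff 1 z ((k (i, j)).2 z)) sP nonres) => // n.
rewrite !mxE (PE n (i, j)) (PE n.+1 (i, j)) opprD addrACA subrr add0r.
rewrite -sumrB; apply: eq_bigr => z _.
by rewrite -ReB horner_geom_diff exprS; congr complex.Re; ring.
Qed.

End StochasticSpectrum.

Theorem theorem1 (R : realType) (d : nat) (hd : (1 < d)%N) (P : 'M[R]_d)
    (hP : stochastic P) (hirr : irreducible P) (haper : aperiodic P)
    (hnr : nonresonant P) :
  benford_matrix P.
Proof.
by case: d hd P hP {hirr haper} hnr => // d _ P; exact: benford_matrix_S.
Qed.
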